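(* Every leading principal minor (i.e. the square submatrix formed by the first $k$ rows and first $k$ columns, for any $1 \le k \le p(n)$) of the zonal character table $(\omega^\lambda_\rho)_{\lambda,\rho \vdash n}$ is invertible, and every entry of the zonal character table has absolute value at most one.
   Context: $\mathcal{M}_{2n}$ is the set of perfect matchings of $K_{2n}$ on $[2n]$, with the natural action of $S_{2n}$; $m^* = \{\{1,2\},\dots,\{2n-1,2n\}\}$ and $H_n \le S_{2n}$ is its stabilizer (the hyperoctahedral group, of order $2^n n!$). For $m,m' \in \mathcal{M}_{2n}$, the multigraph union $m \cup m'$ is a disjoint union of even cycles (a common edge counting as a $2$-cycle); if the cycle lengths are $2\rho_1 \ge 2\rho_2 \ge \dots$, the cycle type is $d(m,m') = (\rho_1,\rho_2,\dots) \vdash n$. For $\lambda \vdash n$ let $\chi^{2\lambda}$ be the irreducible character of $S_{2n}$ indexed by $2\lambda = (2\lambda_1,2\lambda_2,\dots)\vdash 2n$, and define the zonal spherical function $\omega^\lambda(\sigma m^* ) = \frac{1}{|H_n|}\sum_{h \in H_n}\chi^{2\lambda}(\sigma^{-1}h)$; it is constant on each set $\{m : d(m^*,m) = \rho\}$, and $\omega^\lambda_\rho$ denotes this value. The zonal character table is the matrix with rows indexed by $\lambda \vdash n$ and columns by $\rho \vdash n$, both in reverse-lexicographic order ($\mu \le \lambda$ iff $\mu=\lambda$ or $\mu_j<\lambda_j$ at the first differing index $j$), with $(\lambda,\rho)$-entry $\omega^\lambda_\rho$. $p(n)$ is the number of partitions of $n$. *)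

(* Defs.v *)
From mathcomp Require Import all_boot all_order all_algebra all_fingroup.
From mathcomp Require Import all_solvable all_field all_character.
Set Implicit Arguments. Unset Strict Implicit. Unset Printing Implicit Defensive.
Import Order.TTheory GRing.Theory Num.Theory.

Definition is_part (n : nat) (s : seq nat) : bool :=
  [&& sorted geq s, all (fun x => 0 < x) s & sumn s == n].

Fixpoint words (l : nat) (A : seq nat) : seq (seq nat) :=
  if l is l'.+1 then [seq a :: w | a <- A, w <- words l' A] else [:: [::]].

Definition part_candidates (n : nat) : seq (seq nat) :=
  flatten [seq words l (iota 1 n) | l <- iota 0 n.+1].

(* strict lexicographic order: mu < la iff at the first differing index j,
   mu_j < la_j (sequences padded with zeros). *)
Fixpoint lexlt (a b : seq nat) : bool :=
  match a, b with
  | [::], [::] => false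
  | [::], y :: b' => (0 < y) || lexlt [::] b'
  | x :: a', [::] => false
  | x :: a', y :: b' => (x < y) || ((x == y) && lexlt a' b')
  end.

Definition lexle (mu la : seq nat) : bool := (mu == la) || lexlt mu la.

(* The list of all partitions of n, listed from the largest ((n)) down to
   the smallest ((1^n)) in the lexicographic order above. Its size is p(n). *)
Definition partitions (n : nat) : seq (seq nat) :=
  sort (fun la mu => lexle mu la)
       (undup [seq s <- part_candidates n | is_part n s]).

Definition doublep (la : seq nat) : seq nat := [seq 2 * x | x <- la].

Definition conjp (la : seq nat) : seq nat :=
  [seq count (fun x => j < x) la | j <- iota 0 (head 0 la)].

Local Open Scope ring_scope.
Section Chars.
Variable m : nat.
Local Notation gT := {perm 'I_m}.
Local Notation G := [set: gT].

(* block index of x in the set composition of {0..m-1} into consecutive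
   intervals of sizes mu_1, mu_2, ... *)
Definition yblock (mu : seq nat) (x : nat) : nat :=
  count (fun j => sumn (take j.+1 mu) <= x)%N (iota 0 (size mu)).

Definition young_sub (mu : seq nat) : {set gT} :=
  [set s : gT | [forall x : 'I_m, yblock mu (s x) == yblock mu x]].

Definition permchar (mu : seq nat) : 'CF(G) :=
  'Ind[G, <<young_sub mu>>%G] (1 : 'CF(<<young_sub mu>>%G)).

Fact sgn_cf_subproof :
  is_class_fun <<G>>%g [ffun s : gT => ((-1) ^+ odd_perm s : algC)].
Proof.
rewrite genGid; apply: intro_class_fun => [x y _ _ | x]; last by rewrite in_setT.
by rewrite odd_permJ.
Qed.

Definition sgn_cf : 'CF(G) := Cfun 0 sgn_cf_subproof.

(* chi^mu := the unique irreducible character of S_m that is a constituent of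
   both pi^mu and sgn * pi^{mu'} (Young's rule / the standard indexing of the
   irreducible characters of S_m by partitions, chi^(m) = 1, chi^(1^m) = sgn). *)
Definition irr_index (mu : seq nat) : Iirr G :=
  odflt 0 [pick i : Iirr G | ('[permchar mu, 'chi_i] != 0)
                             && ('[sgn_cf * permchar (conjp mu), 'chi_i] != 0)].

Definition chiS (mu : seq nat) : 'CF(G) := 'chi_(irr_index mu).
End Chars.

(* Perfect matchings of K_{2n}, as fixed-point-free involutions of    *)
(* [2n] = {0,...,2n-1}; m* pairs 0-1, 2-3, ...  (i.e. {1,2},{3,4},... *)
(* in 1-based numbering).                                             *)
Section Matchings.
Variable n : nat.
Local Notation T := 'I_(n.*2).
Local Notation gT := {perm T}.

Fact mstar_subproof (x : T) : ((if odd x then x.-1 else x.+1) < n.*2)%N.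
Proof.
case: ifP => ox; first by apply: leq_ltn_trans (leq_pred _) (ltn_ord x).
rewrite ltn_neqAle ltn_ord andbT; apply/eqP => e.
by move: (odd_double n); rewrite -e /= ox.
Qed.

Definition mstar (x : T) : T := Ordinal (mstar_subproof x).

Definition mact (s : gT) (m : T -> T) : T -> T := fun x => s (m ((s^-1)%g x)).

Definition Hn : {set gT} := [set h : gT | [forall x : T, mact h mstar x == mstar x]].

(* cycle type d(m, m') : the halved sizes of the connected components
   (= cycles) of the multigraph m u m', sorted nonincreasingly *)
Definition ctype (m m' : T -> T) : seq nat :=
  let r := [rel x y | (y == m x) || (y == m' x)] in
  sort geq [seq (#|[pred y | connect r x y]|./2)%N | x <- enum (roots r)].

(* zonal spherical function omega^la(sigma m* ) *)
Definition omega (la : seq nat) (s : gT) : algC :=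
  (#|Hn|%:R)^-1 * \sum_(h in Hn) chiS n.*2 (doublep la) (h * s^-1)%g.
(* (h * s^-1)%g is, in MathComp's left-to-right composition, the permutation
   sigma^{-1} o h *)

Definition zonal (la rho : seq nat) : algC :=
  omega la (odflt 1%g [pick s : gT | ctype mstar (mact s mstar) == rho]).

Definition zonal_table_minor (k : nat) : 'M[algC]_k :=
  \matrix_(i < k, j < k)
     zonal (nth [::] (partitions n) i) (nth [::] (partitions n) j).
End Matchings.

(* Main.v *)
Require Import Defs.
From mathcomp Require Import all_boot all_order all_algebra all_fingroup.
From mathcomp Require Import all_solvable all_field all_character.
From mathcomp Require Import zify ring.
Import Order.TTheory GRing.Theory Num.Theory.
Set Implicit Arguments. Unset Strict Implicit. Unset Printing Implicit Defensive.

(* Let phi_mu be the function on H_n\S_2n/H_n giving the proportion of a double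
   coset that lies in the Young subgroup S_(2 mu). Its value at cycle type rho
   vanishes unless rho refines mu, and it is positive at rho = mu. On the other
   hand the coefficient of omega^la in phi_mu vanishes unless chi^(2 la) has
   S_(2 mu)-invariants, hence unless mu <= la. So, with indices running down the
   lexicographic order, the matrix (phi_mu(rho)) is upper triangular with nonzero
   diagonal and equals L times the zonal table with L lower triangular; restricting
   this product to the first k indices, every leading principal minor divides a
   nonzero number.
   That the omega^la span the functions of the cycle type follows from their
   orthogonality, because the table is square.

   The same spanning property forces chi^(2 la) to contain the trivial character
   of H_n exactly once and gives the functional equation
     omega(g) omega(x) = average over k in H_n of omega(g k x);
   at an x = g where |omega| is maximal it yields |omega|^2 <= |omega|.

   That chi^(2 la) does contain the trivial character of H_n is a sign count: if
   h q p = 1 with h in H_n, q in the column group and p in the row group of a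
   tableau of shape 2 la whose columns 2j, 2j+1 are matched by m*, then q is even. *)

(** * Partitions and the lexicographic order *)

(* Truncated subtraction: bounding these sums for all t is the dominance order
   on partitions of the same size. *)
Definition tail_sum (t : nat) (s : seq nat) : nat := sumn [seq x - t | x <- s].

Lemma tail_sum_eq0 t s : all (fun x => x <= t) s -> tail_sum t s = 0.
Proof.
by rewrite /tail_sum; elim: s => //= x s IH /andP[/eqP-> /IH ->].
Qed.

Lemma tail_sum_nth t s : tail_sum t s = \sum_(i < size s) (nth 0 s i - t).
Proof.
by rewrite /tail_sum sumnE big_map (big_nth 0) big_mkord.
Qed.

(** Dominance implies the lexicographic order. If the first differing entries satisfy x > y, then at
    t = y the tail sum of the sorted [b] is zero, while that of [a] is at least x - y > 0. Equal
    heads cancel. *)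
Lemma lexle_tail_sum (a b : seq nat) :
  all (ltn 0) a -> all (ltn 0) b -> sorted geq b ->
  (forall t, tail_sum t a <= tail_sum t b) -> lexle a b.
Proof.
elim: a b => [|x a IH] [|y b] //=.
- by move=> _ /andP[y0 _] _ _; rewrite /lexle /= y0 ?orbT.
- by move=> /andP[x0 _] _ _ /(_ 0); rewrite /tail_sum /=; lia.
move=> /andP[x0 a0] /andP[y0 b0] sb le_ab.
rewrite /lexle /= eqseq_cons; case: (ltngtP x y) => //= xy.
  have le_by : all (fun z => z <= y) (y :: b).
    rewrite /= leqnn /=; apply/allP => z zb.
    by have /allP/(_ z zb) := order_path_min (rev_trans leq_trans) sb.
  by have := le_ab y; rewrite (tail_sum_eq0 le_by) /tail_sum /=; lia.
apply: IH => // [|t]; first exact: path_sorted sb.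
by have := le_ab t; rewrite /tail_sum /= xy; lia.
Qed.

Lemma lexlt_irr a : lexlt a a = false.
Proof. by elim: a => //= x a ->; rewrite ltnn eqxx. Qed.

Lemma lexlt_trans b a c : lexlt a b -> lexlt b c -> lexlt a c.
Proof.
elim: b a c => [|y b IH] [|x a] [|z c] //=.
- move=> /orP[y0|ab] /orP[yz|/andP[/eqP <- bc]]; rewrite ?y0 //.
  + by rewrite (leq_trans _ yz).
  + by rewrite (leq_trans _ yz).
  + by rewrite (IH _ _ ab bc) orbT.
- move=> /orP[xy|/andP[/eqP-> ab]] /orP[yz|/andP[/eqP <- bc]].
  + by rewrite (ltn_trans xy yz).
  + by rewrite xy.
  + by rewrite yz.
  + by rewrite eqxx (IH _ _ ab bc) orbT.
Qed.

Lemma lexle_trans : transitive lexle.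
Proof.
move=> b a c; rewrite /lexle => /orP[/eqP->//|ab] /orP[/eqP<-|bc].
  by rewrite ab orbT.
by rewrite (lexlt_trans ab bc) orbT.
Qed.

Lemma lexle_anti a b : lexle a b -> lexle b a -> a = b.
Proof.
rewrite /lexle => /orP[/eqP->//|ab] /orP[/eqP->//|ba].
by have := lexlt_trans ab ba; rewrite lexlt_irr.
Qed.

Lemma lexle_total a b : all (ltn 0) a -> all (ltn 0) b -> lexle a b || lexle b a.
Proof.
elim: a b => [|x a IH] [|y b] //=.
- by move=> _ /andP[y0 _]; rewrite /lexle /= y0 ?orbT.
- by move=> /andP[x0 _] _; rewrite /lexle /= x0 ?orbT.
move=> /andP[x0 a0] /andP[y0 b0]; rewrite /lexle /= !eqseq_cons.
by case: (ltngtP x y) => //= _; apply: IH.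
Qed.

Lemma mem_words l A w :
  (w \in words l A) = (size w == l) && all [in A] w.
Proof.
elim: l w => [|l IH] w /=; first by rewrite inE; case: w.
apply/allpairsP/idP => [[[a v] /= [aA vA ->]]|].
  by move: vA; rewrite IH /= eqSS aA.
case: w => //= a w; rewrite eqSS => /and3P[sw aA wA].
by exists (a, w); split=> //; rewrite IH sw.
Qed.

Lemma mem_partitions n s : (s \in partitions n) = is_part n s.
Proof.
rewrite mem_sort mem_undup mem_filter; case ps: (is_part n s) => //=.
case/and3P: ps => _ s0 /eqP sn; apply/flattenP.
have le_size : size s <= n by rewrite -sn; elim: (s) s0 => //= x t IH /andP[? /IH]; lia.
exists (words (size s) (iota 1 n)); first by apply/mapP; exists (size s); rewrite // mem_iota; lia.
rewrite mem_words eqxx /=; apply/allP => x xs; rewrite /= mem_iota.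
have x0 := allP s0 x xs; suff: x <= n by lia.
by rewrite -sn; elim: (s) xs => //= y t IH; rewrite inE => /orP[/eqP->|/IH]; lia.
Qed.

Lemma partitions_uniq n : uniq (partitions n).
Proof. by rewrite sort_uniq undup_uniq. Qed.

Lemma partitionsP n s :
  reflect [/\ sorted geq s, all (ltn 0) s & sumn s = n] (s \in partitions n).
Proof.
rewrite mem_partitions; apply: (iffP and3P) => [[? ? /eqP]|[? ? /eqP]] //.
Qed.

(** Turns lexicographic comparisons into comparisons of matrix indices; the direction flips because
    the list is decreasing. *)
Lemma nth_partitions_le n i j :
  i < size (partitions n) -> j < size (partitions n) ->
  lexle (nth [::] (partitions n) i) (nth [::] (partitions n) j) -> j <= i.
Proof.
move=> iN jN le_ij; rewrite leqNgt; apply/negP => lt_ij.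
have sP : sorted (fun la mu => lexle mu la) (partitions n).
  apply: (@sort_sorted_in _ (is_part n)) => [a b|].
    by case/and3P=> _ a0 _ /and3P[_ b0 _]; apply: lexle_total.
  by apply/allP => x; rewrite mem_undup mem_filter => /andP[].
have /(_ i j iN jN lt_ij) le_ji := sorted_ltn_nth (rev_trans lexle_trans) [::] sP.
have /eqP := lexle_anti le_ij le_ji.
by rewrite (nth_uniq _ iN jN (partitions_uniq n)); lia.
Qed.

(** * Tableaux and Young diagrams *)

Lemma fiber_perm m (S : eqType) (f1 f2 : 'I_m -> S) :
    (forall s, #|[pred x | f1 x == s]| = #|[pred x | f2 x == s]|) ->
  exists g : {perm 'I_m}, forall x, f2 (g x) = f1 x.
Proof.
move=> eqf; have: perm_eq [tuple f1 i | i < m] [tuple f2 i | i < m].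
  apply/allP => s _ /=; rewrite !count_map; apply/eqP.
  by move: (eqf s); rewrite !cardE !size_filter /enum_mem -!enumT.
case/tuple_permP=> g def_g; exists g => x.
have := congr1 (fun t => tnth t x) (val_inj def_g).
by rewrite !tnth_mktuple.
Qed.

Lemma card_fibers (T : finType) (A : pred T) (f : T -> nat) N :
  (forall x, A x -> f x < N) ->
  #|[pred x | A x]| = \sum_(i < N) #|[pred x | A x && (f x == i)]|.
Proof.
move=> ltfN; rewrite -sum1_card.
rewrite -(big_mkord xpredT (fun i => #|[pred x | A x && (f x == i)]|)).
under [RHS]eq_bigr => i _ do rewrite -sum1_card big_mkcondr /=.
rewrite exchange_big /=; apply: eq_bigr => x Ax.
rewrite (bigD1_seq (f x)) ?iota_uniq ?mem_index_iota ?ltfN //=.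
by rewrite eqxx big1 // => i /negPf; rewrite eq_sym => ->.
Qed.

(** A bijection from the points to the cells of the Young diagram of [la], recorded by its row and
    column coordinates. *)
Definition tableau m (la : seq nat) (r c : 'I_m -> nat) :=
  [/\ forall x, c x < nth 0 la (r x),
      forall x y, r x = r y -> c x = c y -> x = y
    & forall i j, j < nth 0 la i -> exists x, r x = i /\ c x = j].

Section Tableau.
Variables (m : nat) (la : seq nat) (r c : 'I_m -> nat).
Hypothesis tab : tableau la r c.

Lemma tableau_row x : r x < size la.
Proof.
by case: tab => /(_ x) + _ _; apply: contraTT; rewrite -leqNgt => /(nth_default 0)->.
Qed.

Lemma tableau_card_row i (P : pred nat) :
  #|[pred x | (r x == i) && P (c x)]| = count P (iota 0 (nth 0 la i)).
Proof.
case: tab => ltc inj sur; rewrite cardE -(size_map c) -size_filter.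
apply: perm_size; apply: uniq_perm; first 1 last.
- by rewrite filter_uniq ?iota_uniq.
- move=> j; rewrite mem_filter mem_iota add0n /=; apply/mapP/andP.
    by case=> x; rewrite mem_enum inE => /andP[/eqP <- Px ->].
  case=> Pj /sur[x [rx cx]]; exists x => //.
  by rewrite mem_enum inE rx cx eqxx.
rewrite map_inj_in_uniq ?enum_uniq // => x y.
by rewrite !mem_enum !inE => /andP[/eqP xi _] /andP[/eqP yi _]; apply: inj; rewrite xi.
Qed.

Lemma tableau_card_row_tail i t :
  #|[pred x | (r x == i) && (t <= c x)]| = nth 0 la i - t.
Proof.
rewrite tableau_card_row; elim: (nth 0 la i) => // k IH.
by rewrite -[k.+1]addn1 iotaD count_cat IH /= add0n; case: leqP => /=; lia.
Qed.

Lemma tableau_card_row_all i : #|[pred x | r x == i]| = nth 0 la i.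
Proof.
by rewrite -[RHS]subn0 -tableau_card_row_tail; apply: eq_card => x; rewrite !inE andbT.
Qed.

Lemma tableau_card_tail t : #|[pred x | t <= c x]| = tail_sum t la.
Proof.
rewrite (@card_fibers _ _ r (size la)) => [|x _]; last exact: tableau_row.
rewrite tail_sum_nth; apply: eq_bigr => i _.
by rewrite -tableau_card_row_tail; apply: eq_card => x; rewrite !inE andbC.
Qed.

Lemma tableau_card_col j : #|[pred x | c x == j]| = count (ltn j) la.
Proof.
rewrite (@card_fibers _ _ r (size la)) => [|x _]; last exact: tableau_row.
rewrite -sumn_count sumnE big_map (big_nth 0) big_mkord; apply: eq_bigr => i _.
transitivity (count (pred1 j) (iota 0 (nth 0 la i))); last first.
  by rewrite count_uniq_mem ?iota_uniq // mem_iota add0n.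
by rewrite -tableau_card_row; apply: eq_card => x; rewrite !inE andbC.
Qed.

End Tableau.

(** On a fiber of [f] the map [c] is injective, so at most t of its points have [c x < t]. *)
Lemma card_fiber_tail m (f c : 'I_m -> nat) i t :
  (forall x y, f x = f y -> c x = c y -> x = y) ->
  #|[pred x | f x == i]| - t <= #|[pred x | (f x == i) && (t <= c x)]|.
Proof.
move=> inj; rewrite leq_subLR -(cardID (fun x => c x < t) [pred x | f x == i]).
apply: leq_add; last by apply/eq_leq/eq_card => x; rewrite !inE -leqNgt andbC.
rewrite cardE -(size_map c) -[leqRHS](size_iota 0); apply: uniq_leq_size.
  rewrite map_inj_in_uniq ?enum_uniq // => x y.
  by rewrite !mem_enum !inE => /andP[/eqP xi _] /andP[/eqP yi _]; apply: inj; rewrite xi.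
by move=> j /mapP[x]; rewrite mem_enum !inE mem_iota => /andP[_ ?] ->.
Qed.

(** With [f] the rows of a shape [mu] and [c] the columns of a shape [la], the right side is the
    tail sum of [la], so this is the dominance of [la] over [mu]. *)
Lemma tail_sum_le_card m (mu : seq nat) (f c : 'I_m -> nat) t :
    (forall x y, f x = f y -> c x = c y -> x = y) ->
    (forall x, f x < size mu) ->
    (forall i, #|[pred x | f x == i]| = nth 0 mu i) ->
  tail_sum t mu <= #|[pred x | t <= c x]|.
Proof.
move=> inj ltf card_f; rewrite tail_sum_nth (@card_fibers _ _ f (size mu)) //.
apply: leq_sum => i _; rewrite -card_f.
apply: leq_trans (card_fiber_tail i t inj) _.
by apply/eq_leq/eq_card => x; rewrite !inE andbC.
Qed.

(* The equality case of the previous bound: a 0-1 matrix whose row sums are la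
   and whose column sums are the conjugate of la is the Young diagram of la. *)
Lemma tableau_of_rows m (la : seq nat) (r c f : 'I_m -> nat) :
    tableau la r c ->
    (forall x y, f x = f y -> c x = c y -> x = y) ->
    (forall x, f x < size la) ->
    (forall i, #|[pred x | f x == i]| = nth 0 la i) ->
  exists g : {perm 'I_m}, forall x, f (g x) = r x /\ c (g x) = c x.
Proof.
move=> tab inj ltf card_f.
have tail_le (i : 'I_(size la)) t :
  nth 0 la i - t <= #|[pred x | (t <= c x) && (f x == i)]|.
  rewrite -card_f; apply: leq_trans (card_fiber_tail i t inj) _.
  by apply/eq_leq/eq_card => x; rewrite !inE andbC.
have tail i t : #|[pred x | (f x == i) && (t <= c x)]| = nth 0 la i - t.
  have [lt_i|ge_i] := ltnP i (size la); last first.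
    rewrite nth_default // sub0n; apply: eq_card0 => x; rewrite !inE.
    by apply/negP => /andP[/eqP fx _]; have := ltf x; rewrite fx; lia.
  (* The termwise bounds [tail_le] add up to an equality, so each of them is an equality. *)
  have/eqP: #|[pred x | t <= c x]| = tail_sum t la by apply: tableau_card_tail tab t.
  rewrite tail_sum_nth (@card_fibers _ _ f (size la)) // eq_sym.
  rewrite (eq_leqif (leqif_sum (fun j _ => leqif_eq (tail_le j t)))).
  move=> /forallP/(_ (Ordinal lt_i))/eqP ->.
  by apply: eq_card => x; rewrite !inE andbC.
have cell i j : #|[pred x | (f x == i) && (c x == j)]| = (j < nth 0 la i).
  have -> : nat_of_bool (j < nth 0 la i) = nth 0 la i - j - (nth 0 la i - j.+1).
    by case: ltnP => /=; lia.
  rewrite -!tail -(cardID (fun x => c x == j) [pred x | (f x == i) && (j <= c x)]).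
  rewrite -[LHS](addnK #|[predD [pred x | (f x == i) && (j <= c x)] & (fun x => c x == j)]|).
  congr (_ + _ - _); apply: eq_card => x; rewrite !inE unfold_in.
    by case: (c x =P j) => [->|_]; rewrite ?leqnn ?andbT ?andbF.
  by rewrite andbCA [j < _]ltn_neqAle [j == _]eq_sym.
pose F g (x : 'I_m) := (g x : nat, c x).
have [[i j]|] := @fiber_perm _ _ (F r) (F f); last first.
  by move=> g eq_g; exists g => x; have [] := eq_g x.
have -> : #|[pred x | F r x == (i, j)]| = count (pred1 j) (iota 0 (nth 0 la i)).
  rewrite -(tableau_card_row tab).
  by apply: eq_card => x; rewrite !inE.
rewrite count_uniq_mem ?iota_uniq // mem_iota add0n /= -cell.
by apply: eq_card => x; rewrite !inE.
Qed.

(** * Consecutive blocks as a tableau, and conjugate shapes *)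

Lemma leq_sumn_take (s : seq nat) a b : a <= b -> sumn (take a s) <= sumn (take b s).
Proof. by move=> /subnKC <-; rewrite takeD sumn_cat leq_addr. Qed.

Lemma yblockE (mu : seq nat) x : x < sumn mu -> yblock mu x = reshape_index mu x.
Proof.
move=> ltx; set i := reshape_index mu x; pose j := reshape_offset mu x.
have lti : i < size mu := reshape_indexP ltx.
have ltj : j < nth 0 mu i := reshape_offsetP ltx.
have def_x : x = sumn (take i mu) + j by rewrite -[LHS](reshape_indexK mu).
have -> : yblock mu x = count (fun k => k < i) (iota 0 (size mu)).
  apply: eq_in_count => k _; rewrite def_x; have [lt_ki|le_ik] := ltnP k i.
    by rewrite (leq_trans (leq_sumn_take mu lt_ki)) ?leq_addr.
  apply/negbTE; rewrite -ltnNge.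
  apply: leq_trans (leq_sumn_take mu (le_ik : i < k.+1)).
  by rewrite (take_nth 0 lti) -cats1 sumn_cat /= addn0 ltn_add2l.
rewrite -(subnKC (ltnW lti)) iotaD count_cat.
rewrite (eq_in_count (a2 := predT)) => [|k]; last by rewrite mem_iota.
rewrite count_predT size_iota (eq_in_count (a2 := pred0)) ?count_pred0 ?addn0 //.
by move=> k; rewrite mem_iota /= => /andP[+ _]; rewrite leqNgt => /negbTE.
Qed.

Definition yoffset (mu : seq nat) (x : nat) := reshape_offset mu x.

Lemma yblock_tableau m (mu : seq nat) :
  sumn mu = m -> tableau mu (yblock mu : 'I_m -> nat) (yoffset mu : 'I_m -> nat).
Proof.
move=> sum_mu; split=> [x|x y|i j ltj].
- by rewrite yblockE ?reshape_offsetP ?sum_mu.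
- rewrite !yblockE ?sum_mu // => eq_r eq_c; apply: val_inj.
  by rewrite /= -(reshape_indexK mu x) -(reshape_indexK mu y) eq_r; congr flatten_index.
- have ltm : flatten_index mu i j < m by rewrite -sum_mu flatten_indexP.
  exists (Ordinal ltm); rewrite /= yblockE ?sum_mu //.
  by rewrite flatten_indexKl // /yoffset flatten_indexKr.
Qed.

Lemma nth_conjp la j : sorted geq la -> nth 0 (conjp la) j = count (ltn j) la.
Proof.
move=> sla; have [ltj|lej] := ltnP j (head 0 la).
  by rewrite (nth_map 0) ?size_iota // nth_iota.
rewrite nth_default ?size_map ?size_iota // (eq_in_count (a2 := pred0)) ?count_pred0 //.
case: la sla lej => //= x s /(order_path_min (rev_trans leq_trans))/allP le_s lej y.
by rewrite inE ltnNge => /orP[/eqP->|/le_s le_y]; rewrite ?lej //= (leq_trans le_y).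
Qed.

Lemma sumn_conjp m la (r c : 'I_m -> nat) :
  tableau la r c -> sorted geq la -> sumn (conjp la) = m.
Proof.
move=> tab sla; rewrite -[RHS]card_ord.
transitivity #|[pred x : 'I_m | predT x]|; last by apply: eq_card.
rewrite (@card_fibers _ _ c (size (conjp la))) => [|x _].
  rewrite sumnE (big_nth 0) big_mkord; apply: eq_bigr => j _.
  by rewrite nth_conjp // -(tableau_card_col tab).
rewrite ltnNge; apply/negP => /(nth_default 0).
rewrite nth_conjp // -(tableau_card_col tab) => /card0_eq/(_ x).
by rewrite !inE eqxx.
Qed.

(** Up to relabelling the points, the column group of a tableau of shape [la] is the Young subgroup
    of the conjugate partition; this links [permchar (conjp la)] to columns. *)
Lemma yblock_conjp m la (r c : 'I_m -> nat) :
    tableau la r c -> sorted geq la ->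
  exists g : {perm 'I_m}, forall x, yblock (conjp la) (g x) = c x.
Proof.
move=> tab sla; have sum_m := sumn_conjp tab sla.
apply: (@fiber_perm _ _ c (yblock (conjp la) : 'I_m -> nat)) => j.
by rewrite (tableau_card_col tab) -nth_conjp // (tableau_card_row_all (yblock_tableau sum_m)).
Qed.

(** * Sums of irreducible characters *)

Section CharacterSums.
Local Open Scope ring_scope.
Variable gT : finGroupType.
Local Notation G := [set: gT].
Implicit Types (i j : Iirr G) (a b x y z : gT).

Lemma irr_mulC i x y : 'chi_i (x * y)%g = 'chi_i (y * x)%g.
Proof. by rewrite -(cfunJ _ (x * y)%g (in_setT x)) conjgE -mulgA mulKg. Qed.

Definition irr_ratio i : algC := #|G|%:R / 'chi_i 1%g.

Lemma irr_ratio_neq0 i : irr_ratio i != 0.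
Proof. by rewrite mulf_neq0 ?invr_eq0 ?irr1_neq0 ?neq0CG. Qed.

Lemma irr_orthogonality i j a b :
  \sum_z 'chi_i (a * z)%g * ('chi_j (b * z)%g)^* =
    (i == j)%:R * irr_ratio i * 'chi_i (a * b^-1)%g.
Proof.
have := generalized_orthogonality_relation (b^-1 * a)%g i j.
move/(congr1 ( *%R #|G|%:R)); rewrite mulVKf ?neq0CG // => orth.
transitivity (#|G|%:R * ((i == j)%:R * ('chi_i (b^-1 * a)%g / 'chi_i 1%g))); last first.
  by rewrite /irr_ratio irr_mulC; field; apply: irr1_neq0.
rewrite -{}orth.
rewrite (reindex_inj (mulIg b^-1)%g) /=.
apply: eq_big => [z|z _]; rewrite ?in_setT // -irr_inv irr_mulC mulgA; congr (_ * _).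
  by rewrite mulgA.
by rewrite !irr_inv irr_mulC mulKg.
Qed.

(** The average of the conjugates of b acts as a scalar on the representation. In terms of
    characters, the sum is a class function of b orthogonal to every irreducible character but
    ['chi_i]. *)
Lemma sum_irr_conj i a b :
  \sum_g 'chi_i (a * b ^ g)%g = irr_ratio i * 'chi_i a * 'chi_i b.
Proof.
have Kcf : is_class_fun <<G>>%g [ffun x => \sum_g 'chi_i (a * x ^ g)%g].
  rewrite genGid; apply: intro_class_fun => [x y _ _ | x]; last by rewrite in_setT.
  by rewrite [RHS](reindex_inj (mulgI y)); apply: eq_bigr => g _; rewrite conjgM.
pose K : 'CF(G) := Cfun 0 Kcf.
have KE x : K x = \sum_g 'chi_i (a * x ^ g)%g by rewrite cfunElock.
have K_dot j : '[K, 'chi_j] = (i == j)%:R * irr_ratio i * 'chi_i a.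
  rewrite cfdotE; apply: canLR (mulKf (neq0CG _)) _.
  rewrite big_mkcond /=.
  under eq_bigr => x _ do rewrite in_setT KE mulr_suml.
  rewrite exchange_big -[a in RHS]mulg1 -invg1 -irr_orthogonality.
  rewrite -sumr_const big_distrl /=; apply: eq_big => [g|g _]; first by rewrite in_setT.
  rewrite mul1r (reindex_inj (conjg_inj g^-1)%g) /=; apply: eq_bigr => x _.
  by rewrite conjgKV mul1g cfunJ ?in_setT.
rewrite -KE [K]cfun_sum_cfdot sum_cfunE (bigD1 i) //= cfunE big1 ?addr0 => [|j /negPf].
  congr (_ * _); rewrite K_dot eqxx mul1r //.
by rewrite cfunE K_dot eq_sym => ->; rewrite !mul0r.
Qed.

(** Positivity: by [irr_orthogonality], the Gram sum times [irr_ratio i] equals the sum over z of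
    the squared moduli of the quantities claimed to vanish. *)
Lemma gram_irr_eq0 (I : finType) (P : pred I) (al : I -> algC) (g : I -> gT) i :
    \sum_(a | P a) \sum_(b | P b) al a * (al b)^* * 'chi_i (g a * (g b)^-1)%g = 0 ->
  forall z, \sum_(a | P a) al a * 'chi_i (g a * z)%g = 0.
Proof.
move=> gram0 z; pose u z := \sum_(a | P a) al a * 'chi_i (g a * z)%g.
have: \sum_z `|u z| ^+ 2 = 0.
  transitivity (irr_ratio i * (\sum_(a | P a) \sum_(b | P b)
      al a * (al b)^* * 'chi_i (g a * (g b)^-1)%g)); last first.
    by rewrite gram0 mulr0.
  under eq_bigr => w _.
    rewrite normCK rmorph_sum big_distrlr /=; over.
  rewrite exchange_big mulr_sumr; apply: eq_bigr => a _ /=.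
  rewrite exchange_big mulr_sumr; apply: eq_bigr => b _ /=.
  transitivity (al a * (al b)^* * \sum_w 'chi_i (g a * w)%g * ('chi_i (g b * w)%g)^*).
    by rewrite mulr_sumr; apply: eq_bigr => w _; rewrite rmorphM mulrACA.
  by rewrite irr_orthogonality eqxx mul1r mulrCA.
move=> /eqP; rewrite psumr_eq0 => [/allP/(_ z)|w _]; last by rewrite exprn_ge0.
by rewrite mem_index_enum => /(_ isT)/=; rewrite sqrf_eq0 normr_eq0 => /eqP.
Qed.

End CharacterSums.

(** * Young subgroups *)

Section YoungSubgroups.
Local Open Scope ring_scope.
Variable m : nat.
Local Notation gT := {perm 'I_m}.
Local Notation G := [set: gT].
Local Notation sgp s := ((-1) ^+ odd_perm s : algC).
Implicit Types (i j : Iirr G) (f c r : 'I_m -> nat) (s p q : gT).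

(** Young subgroup of an arbitrary labelling: [yblock mu] gives [young_sub mu], and the coordinates
    of a tableau give its row and column groups. *)
Definition fiber_stab f : {set gT} := [set s : gT | [forall x, f (s x) == f x]].

Lemma fiber_stabP f s : reflect (forall x, f (s x) = f x) (s \in fiber_stab f).
Proof. by rewrite inE; apply: (iffP forallP) => fs x; apply/eqP. Qed.

Lemma fiber_stab_group_set f : group_set (fiber_stab f).
Proof.
apply/group_setP; split=> [|s t /fiber_stabP fs /fiber_stabP ft].
  by apply/fiber_stabP => x; rewrite perm1.
by apply/fiber_stabP => x; rewrite permM ft fs.
Qed.
Canonical fiber_stab_group f := group (fiber_stab_group_set f).

(** Up to the order of the subgroup, [row_sum] and [col_sum] are the multiplicities of its trivial
    and sign characters in the restriction of ['chi_i]. *)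
Definition row_sum i f := \sum_(p in fiber_stab f) 'chi_i p.
Definition col_sum i f := \sum_(q in fiber_stab f) sgp q * 'chi_i q.

Lemma permchar_neq0 mu i :
  ('[permchar m mu, 'chi_i] != 0) = (row_sum i (yblock mu) != 0).
Proof.
rewrite -Frobenius_reciprocity cfdotE mulf_eq0 invr_eq0 (negPf (neq0CG _)) /=.
rewrite -[in RHS]conjC_eq0 rmorph_sum /row_sum -(genGid (fiber_stab_group (yblock mu))).
congr (_ != 0); apply: eq_bigr => p Yp.
by rewrite cfResE ?subsetT // cfun1E Yp mul1r.
Qed.

Lemma sgn_permchar_neq0 mu i :
  ('[sgn_cf m * permchar m mu, 'chi_i] != 0) = (col_sum i (yblock mu) != 0).
Proof.
have sgn_real x : (sgn_cf m x)^* = sgn_cf m x.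
  by rewrite cfunElock rmorph_sign.
have mulE (phi psi : 'CF(G)) x : (phi * psi) x = phi x * psi x by rewrite cfunE.
have -> : '[sgn_cf m * permchar m mu, 'chi_i] = '[permchar m mu, sgn_cf m * 'chi_i].
  rewrite !cfdotE; congr (_ * _); apply: eq_bigr => x _.
  by rewrite !mulE rmorphM /= sgn_real mulrCA mulrA.
rewrite -Frobenius_reciprocity cfdotE mulf_eq0 invr_eq0 (negPf (neq0CG _)) /=.
rewrite -[in RHS]conjC_eq0 rmorph_sum /col_sum -(genGid (fiber_stab_group (yblock mu))).
congr (_ != 0); apply: eq_bigr => p Yp.
by rewrite cfResE ?subsetT // cfun1E Yp mul1r mulE cfunElock.
Qed.

Lemma col_sum_conj i f1 f2 (g : gT) : (forall x, f2 (g x) = f1 x) -> col_sum i f2 = col_sum i f1.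
Proof.
move=> f21; rewrite /col_sum (reindex_inj (conjg_inj g)) /=; apply: eq_big => [s|s _].
  apply/fiber_stabP/fiber_stabP => fs x.
    by rewrite -!f21 -(fs (g x)) conjgE !permM permK.
  by rewrite conjgE !permM f21 fs -f21 permKV.
by rewrite odd_permJ cfunJ ?in_setT.
Qed.

(** The character at a generalized Young symmetrizer: row symmetrizer, x, column antisymmetrizer,
    z. *)
Definition young_sum i r c (x z : gT) :=
  \sum_(p in fiber_stab r) \sum_(q in fiber_stab c) sgp q * 'chi_i (p * x * q * z)%g.

(** The transposition of u and v lies in the column group, and its conjugate by the inverse of x in
    the row group. Absorbing one on each side leaves the product unchanged but reverses the sign. *)
Lemma young_sum_eq0 i r c (x z : gT) (u v : 'I_m) :
    u != v -> r ((x^-1)%g u) = r ((x^-1)%g v) -> c u = c v ->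
  young_sum i r c x z = 0.
Proof.
move=> neq_uv eq_r eq_c; set S := young_sum _ _ _ _ _.
pose t := tperm u v.
have tC : t \in fiber_stab c.
  by apply/fiber_stabP => w; rewrite /t; case: tpermP => // ->.
have tR : (t ^ x^-1)%g \in fiber_stab r.
  by apply/fiber_stabP => w; rewrite tpermJ; case: tpermP => // ->.
suff: S = - S by move/eqP; rewrite -addr_eq0 -mulr2n mulrn_eq0 => /eqP.
rewrite {1}/S /young_sum (reindex_inj (mulIg (t ^ x^-1)^-1)%g) /= -sumrN.
apply: eq_big => [p|p _]; first by rewrite groupMr ?groupV.
rewrite (reindex_inj (mulgI t)) /= -sumrN.
apply: eq_big => [q|q _]; first by rewrite groupMl.
rewrite odd_permM odd_tperm neq_uv signr_addb expr1 !mulN1r mulNr; congr (- (_ * 'chi_i _)).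
rewrite conjgE invgK; rewrite !invMg invgK !mulgA mulgKV.
by rewrite /t tpermV -!mulgA (mulgA (tperm u v)) tperm2 mul1g.
Qed.

(** By [sum_irr_conj], the sum over g of the Young sums is a nonzero multiple of
    [row_sum i f * col_sum i c], so some g contributes; [young_sum_eq0] then excludes two points
    sharing both labels. *)
Lemma young_pair_inj i f c : row_sum i f != 0 -> col_sum i c != 0 ->
  exists g : gT, (forall u v, f (g u) = f (g v) -> c u = c v -> u = v)
    /\ young_sum i f c g^-1 g != 0.
Proof.
move=> f0 c0; have: \sum_g young_sum i f c g^-1 g != 0.
  have -> : \sum_g young_sum i f c g^-1 g = irr_ratio i * row_sum i f * col_sum i c.
    rewrite /row_sum /col_sum -mulrA big_distrlr mulr_sumr exchange_big.
    apply: eq_bigr => p _ /=; rewrite mulr_sumr exchange_big; apply: eq_bigr => q _ /=.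
    rewrite -mulr_sumr mulrCA mulrA (mulrCA _ _ ('chi_i q)).
    transitivity (sgp q * \sum_g 'chi_i (p * q ^ g)%g).
      by congr (_ * _); apply: eq_bigr => g _; rewrite conjgE !mulgA.
    rewrite sum_irr_conj; move: (sgp q) (irr_ratio i) ('chi_i p) ('chi_i q) => a b x y.
    by ring.
  by do 2!apply: mulf_neq0 => //; apply: irr_ratio_neq0.
move=> sum_neq0; have [g g_neq0|all0] := pickP (fun g : gT => young_sum i f c g^-1 g != 0).
  exists g; split=> // u v eq_f eq_c; apply/eqP; apply: contraNT g_neq0 => neq_uv.
  by rewrite (young_sum_eq0 _ _ neq_uv) ?invgK.
by rewrite big1 ?eqxx // in sum_neq0 => g _; apply/eqP; rewrite -[_ == _]negbK all0.
Qed.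

(** Von Neumann's lemma: either a transposition kills the sum, or x is a product of a row and a
    column permutation. The sign depends on x alone, so that two characters can be compared. *)
Lemma young_sum_tableau la r c (x : gT) : tableau la r c ->
     (forall i z, young_sum i r c x z = 0)
  \/ exists e : bool, forall i z, young_sum i r c x z = (-1) ^+ e * young_sum i r c 1 z.
Proof.
move=> tab.
case: (pickP (fun uv : 'I_m * 'I_m => [&& uv.1 != uv.2,
    r ((x^-1)%g uv.1) == r ((x^-1)%g uv.2) & c uv.1 == c uv.2])) => [[u v]|no_uv].
  move=> /and3P[neq_uv /eqP eq_r /eqP eq_c]; left=> i z.
  exact: young_sum_eq0 neq_uv eq_r eq_c.
(* Without a bad pair, the rows pulled back by x fall in the equality case; the resulting [g] is in
   the column group and [x * g^-1] in the row group. *)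
right; have [|w|k|g rcg] := tableau_of_rows tab (f := fun w => r ((x^-1)%g w)).
- move=> u v eq_r eq_c; apply/eqP; have:= no_uv (u, v).
  by rewrite /= eq_r eq_c !eqxx /= !andbT; case: eqP.
- exact: tableau_row tab _.
- rewrite -(tableau_card_row_all tab) -(card_imset [pred w | r w == k] (@perm_inj _ x)).
  apply: eq_card => w; rewrite !inE; apply/idP/imsetP => [rw|[w' + ->]].
    by exists ((x^-1)%g w); rewrite ?inE ?permKV.
  by rewrite inE permK.
have gC : g \in fiber_stab c by apply/fiber_stabP => w; case: (rcg w).
have gR : (x * g^-1)%g \in fiber_stab r.
  rewrite -groupV invMg invgK; apply/fiber_stabP => w.
  by rewrite permM; case: (rcg w).
exists (odd_perm g) => i z; rewrite /young_sum mulr_sumr.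
rewrite (reindex_inj (mulIg (x * g^-1)^-1)%g) /=.
apply: eq_big => [p|p _]; first by rewrite groupMr ?groupV.
rewrite mulr_sumr (reindex_inj (mulgI g^-1)%g) /=.
apply: eq_big => [q|q _]; first by rewrite groupMl ?groupV.
rewrite odd_permM odd_permV signr_addb -mulrA; congr (_ * (_ * 'chi_i _)).
by rewrite mulg1 invMg invgK !mulgA mulgKV mulgK.
Qed.

Lemma young_sum_orthogonality i j r c z w : i != j ->
  \sum_x young_sum i r c x z * (young_sum j r c x w)^* = 0.
Proof.
move=> /negPf ne_ij.
under eq_bigr => x _ do rewrite rmorph_sum big_distrlr /=.
rewrite exchange_big big1 // => p _ /=; rewrite exchange_big big1 // => p' _ /=.
under eq_bigr => x _ do rewrite rmorph_sum big_distrlr /=.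
rewrite exchange_big big1 // => q _ /=; rewrite exchange_big big1 // => q' _ /=.
transitivity (sgp q * (sgp q')^* *
  \sum_x 'chi_i ((q * z * p) * x)%g * ('chi_j ((q' * w * p') * x)%g)^*).
  rewrite mulr_sumr; apply: eq_bigr => x _; rewrite rmorphM mulrACA.
  by rewrite -!(mulgA _ _ z) -!(mulgA _ _ w) irr_mulC (irr_mulC j) !mulgA.
by rewrite irr_orthogonality ne_ij !mul0r mulr0.
Qed.

(** For distinct i and j the two Young sums are orthogonal functions of x. But by
    [young_sum_tableau] their product takes only the values 0 and [F 1], with [F 1] nonzero, so its
    sum cannot vanish. *)
Lemma young_irr_uniq la r c i j : tableau la r c ->
  row_sum i r != 0 -> col_sum i c != 0 -> row_sum j r != 0 -> col_sum j c != 0 -> i = j.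
Proof.
move=> tab ri ci rj cj; apply/eqP/negPn/negP => ne_ij.
have nz k : row_sum k r != 0 -> col_sum k c != 0 -> exists z, young_sum k r c 1 z != 0.
  move=> rk ck; have [g [_ nz_g]] := young_pair_inj rk ck; exists g.
  by case: (young_sum_tableau g^-1 tab) nz_g => [->|[e ->]]; rewrite ?eqxx // mulf_eq0 signr_eq0.
have [[z nz_z] [w nz_w]] := (nz i ri ci, nz j rj cj).
pose F x := young_sum i r c x z * (young_sum j r c x w)^*.
have /eqP := young_sum_orthogonality r c z w ne_ij; rewrite -/F.
have F1 : F 1%g != 0 by rewrite mulf_neq0 ?conjC_eq0.
have -> : \sum_x F x = F 1%g *+ #|[pred x | F x == F 1%g]|.
  rewrite -sumr_const [RHS]big_mkcond; apply: eq_bigr => x _ /=; rewrite inE.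
  case: eqP => // ; rewrite /F.
  case: (young_sum_tableau x tab) => [->|[e ysE]]; first by rewrite mul0r.
  by rewrite !ysE rmorphM rmorph_sign mulrACA -expr2 sqrr_sign mul1r.
rewrite mulrn_eq0 (negPf F1) orbF => /eqP/card0_eq/(_ 1%g).
by rewrite inE eqxx.
Qed.

End YoungSubgroups.

(** * The hyperoctahedral group *)

Section Hyperoctahedral.
Local Open Scope ring_scope.
Variable n : nat.
Local Notation T := 'I_(n.*2).
Local Notation gT := {perm T}.
Local Notation G := [set: gT].
Local Notation sgp s := ((-1) ^+ odd_perm s : algC).
Implicit Types (i j : Iirr G) (p q h g s : gT).

(** The rule of [mstar] on plain naturals, so that it also applies to column numbers. *)
Definition flip (k : nat) := if odd k then k.-1 else k.+1.

Lemma odd_flip k : odd (flip k) = ~~ odd k.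
Proof. by rewrite /flip; case: ifP => ok; lia. Qed.

Lemma flipK k : flip (flip k) = k.
Proof. by rewrite {1}/flip odd_flip /flip; case: (boolP (odd k)) => ok //=; lia. Qed.

Lemma val_mstar (x : T) : mstar x = flip x :> nat.
Proof. by []. Qed.

Lemma mstarK : involutive (@mstar n).
Proof. by move=> x; apply: ord_inj; rewrite !val_mstar flipK. Qed.

Lemma mstar_neq (x : T) : mstar x != x.
Proof.
by apply/eqP => /(congr1 (fun y : T => odd y)); rewrite val_mstar odd_flip; case: odd.
Qed.

Lemma HnP h : reflect (forall x, h (mstar x) = mstar (h x)) (h \in Hn n).
Proof.
rewrite inE; apply: (iffP forallP) => hm x; rewrite /Defs.mact.
  by have /eqP := hm (h x); rewrite /Defs.mact permK.
by rewrite hm permKV.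
Qed.

Lemma Hn_group_set : group_set (Hn n).
Proof.
apply/group_setP; split=> [|s t /HnP hs /HnP ht]; apply/HnP => x.
  by rewrite !perm1.
by rewrite !permM hs ht.
Qed.
Canonical Hn_group := group Hn_group_set.

(** Each edge of m* is a horizontal domino on columns 2j and 2j+1. *)
Definition doubled_tableau la (r c : T -> nat) :=
  [/\ tableau (doublep la) r c, forall x, r (mstar x) = r x
    & forall x, c (mstar x) = flip (c x)].

Lemma sumn_doublep la : sumn (doublep la) = (sumn la).*2.
Proof. by elim: la => //= k la ->; lia. Qed.

Lemma nth_doublep la (k : nat) : nth 0%N (doublep la) k = (2 * nth 0 la k)%N.
Proof.
have [ltk|lek] := ltnP k (size la); first by rewrite (nth_map 0%N).
by rewrite !nth_default ?size_map.
Qed.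

(** All rows have even length, so each block starts at an even number and the parity of a point is
    that of its column. *)
Lemma doubled_yblock la : sumn la = n ->
  doubled_tableau la (yblock (doublep la) : T -> nat) (yoffset (doublep la) : T -> nat).
Proof.
move=> sum_la; have sum_dla : sumn (doublep la) = n.*2 by rewrite sumn_doublep sum_la.
have key (x : T) : yblock (doublep la) (mstar x) = yblock (doublep la) x /\
    yoffset (doublep la) (mstar x) = flip (yoffset (doublep la) x).
  rewrite !yblockE ?sum_dla // val_mstar /yoffset.
  have ltx : (x < sumn (doublep la))%N by rewrite sum_dla.
  set i := reshape_index _ x; set j := reshape_offset _ x.
  have lt_j : (j < nth 0 (doublep la) i)%N := reshape_offsetP ltx.
  have lt_fj : (flip j < nth 0 (doublep la) i)%N.
    by move: lt_j; rewrite nth_doublep /flip; case: ifP => oj; lia.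
  suff -> : flip x = flatten_index (doublep la) i (flip j).
    by rewrite flatten_indexKl // flatten_indexKr.
  rewrite -[in LHS](reshape_indexK (doublep la) x) -/i -/j /flatten_index /flip.
  have -> : take i (doublep la) = doublep (take i la) by rewrite /doublep map_take.
  by rewrite sumn_doublep oddD odd_double /=; case: (boolP (odd j)) => oj; lia.
split; first exact: yblock_tableau.
  by move=> x; case: (key x).
by move=> x; case: (key x).
Qed.

(* Such a q acts in the same way on the even columns and on the odd ones. *)
Lemma Hn_col_even la r c q : doubled_tableau la r c ->
  q \in Hn n -> q \in fiber_stab c -> odd_perm q = false.
Proof.
move=> [_ _ cm] /HnP qm /fiber_stabP qc.
pose X : {set T} := [set x | odd (c x)].
have nXq : q \in ('N(X | 'P))%g.
  by rewrite !inE /=; apply/subsetP => x; rewrite !inE /= apermE qc.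
pose ms : gT := perm (can_inj mstarK).
pose u := restr_perm X q.
have uX x : x \in X -> u x = q x by move=> Xx; rewrite /u restr_permE.
have uNX x : x \notin X -> u x = x by move=> Xx; rewrite /u (out_perm (restr_perm_on _ _)).
have msV : (ms^-1)%g = ms.
  by apply/permP => x; apply: (@perm_inj _ ms); rewrite permKV !permE mstarK.
have msX x : (mstar x \in X) = (x \notin X) by rewrite !inE cm odd_flip.
(* [ms] exchanges [X] with its complement and commutes with [q]; the two factors are conjugate, so
   their parities cancel. *)
have -> : q = (u * u ^ ms)%g.
  apply/permP => x; rewrite permM conjgE !permM msV ![ms _]permE.
  have [Xx|NXx] := boolP (x \in X).
    rewrite (uX x) // (uNX (mstar _)) ?mstarK // msX negbK inE qc.
    by rewrite inE in Xx.
  by rewrite (uNX x) // uX ?msX // qm mstarK.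
by rewrite odd_permM odd_permJ addbb.
Qed.

(** Reduces to [Hn_col_even] by showing that the inverse of q commutes with [mstar]: the point [w]
    below has the row and the column of [mstar y], hence equals it. *)
Lemma Hn_row_col_even la r c h q p : doubled_tableau la r c ->
    h \in Hn n -> q \in fiber_stab c -> p \in fiber_stab r ->
  (h * q * p = 1)%g -> odd_perm q = false.
Proof.
move=> dt Hh Cq Rp hqp; have [tab rm cm] := dt; have [_ inj _] := tab.
rewrite -odd_permV; apply: (Hn_col_even dt); last by rewrite groupV.
have Cq' : (q^-1)%g \in fiber_stab c by rewrite groupV.
have Rp' : (p^-1)%g \in fiber_stab r by rewrite groupV.
move: Cq' Rp' Rp => /fiber_stabP qc /fiber_stabP p'r /fiber_stabP pr.
have hE x : h x = (q^-1)%g ((p^-1)%g x).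
  by rewrite -permM; congr (fun_of_perm _ x); apply/eqP; rewrite -invMg eq_mulgV1 invgK mulgA hqp.
have /HnP hm := Hh; apply/HnP => y; set q' := (q^-1)%g in qc *.
pose w := (p^-1)%g (mstar (p y)).
have q'w : q' w = mstar (q' y) by rewrite -hE hm hE permK.
suff <- : w = mstar y by [].
apply: inj; first by rewrite /w p'r !rm pr.
by rewrite -qc q'w !cm qc.
Qed.

Lemma sum_irr1_mul (x : gT) :
  \sum_i 'chi[G]_i 1%g * 'chi_i x = (#|G| * (x == 1%g))%:R.
Proof.
have := cfRegE [set: gT] x; rewrite cfReg_sum sum_cfunE => regE.
transitivity (#|G|%:R *+ (x == 1%g) : algC); last by rewrite natrM mulr_natr.
by rewrite -regE; apply: eq_bigr => i _; rewrite cfunE.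
Qed.

Definition Hn_sum i := \sum_(h in Hn n) 'chi_i h.
Definition Hn_row_sum i r := \sum_(h in Hn n) \sum_(p in fiber_stab r) 'chi_i (h * p)%g.

(** A representation without A-invariants is annihilated by the sum over A. The next lemma is the
    sign-twisted version. *)
Lemma group_sum_eq0 i (A : {group gT}) : \sum_(p in A) 'chi_i p = 0 ->
  forall z, \sum_(p in A) 'chi_i (p * z)%g = 0.
Proof.
move=> sumA z; transitivity (\sum_(p in A) 1 * 'chi_i (p * z)%g).
  by apply: eq_bigr => p _; rewrite mul1r.
apply: (@gram_irr_eq0 gT gT (mem A) (fun=> 1) id i _ z).
rewrite exchange_big big1 // => p Rp /=; rewrite -[RHS]sumA [RHS](reindex_inj (mulIg p^-1)%g).
by apply: eq_big => [q|q _]; rewrite ?conjC1 ?mul1r // groupMr ?groupV.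
Qed.

Lemma col_sum_eq0 i (c : T -> nat) : col_sum i c = 0 ->
  forall z, \sum_(q in fiber_stab c) sgp q * 'chi_i (q * z)%g = 0.
Proof.
move=> c0 z.
apply: (@gram_irr_eq0 gT gT (mem (fiber_stab c)) (fun q => sgp q) id i _ z).
rewrite exchange_big big1 // => p Rp /=; rewrite -[RHS]c0 [RHS](reindex_inj (mulIg p^-1)%g).
apply: eq_big => [q|q _]; first by rewrite groupMr ?groupV.
by rewrite odd_permM odd_permV signr_addb rmorph_sign.
Qed.

(** Weighting [S i] by the degree and summing over i evaluates the regular character, which counts
    the triples with h q p = 1. All signs are positive by [Hn_row_col_even], and the trivial triple
    occurs, so some [S i] is nonzero; a vanishing factor would make it zero. *)
Lemma doubled_irr_exists la r c : doubled_tableau la r c ->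
  exists i, [/\ row_sum i r != 0, col_sum i c != 0 & Hn_sum i != 0].
Proof.
move=> dt.
pose S i := \sum_(h in Hn n) \sum_(q in fiber_stab c) \sum_(p in fiber_stab r)
   sgp q * 'chi_i (h * q * p)%g.
have [i Si|S0] := pickP (fun i : Iirr G => S i != 0); last first.
  have: \sum_i 'chi_i 1%g * S i = 0.
    by rewrite big1 // => i _; have /negbFE/eqP-> := S0 i; rewrite mulr0.
  have -> : \sum_i 'chi[G]_i 1%g * S i = \sum_(h in Hn n) \sum_(q in fiber_stab c)
      \sum_(p in fiber_stab r) (#|G| * (h * q * p == 1)%g)%:R.
    under eq_bigr => i _ do rewrite mulr_sumr; rewrite exchange_big; apply: eq_bigr => h Hh /=.
    under eq_bigr => i _ do rewrite mulr_sumr; rewrite exchange_big; apply: eq_bigr => q Cq /=.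
    under eq_bigr => i _ do rewrite mulr_sumr; rewrite exchange_big; apply: eq_bigr => p Rp /=.
    under eq_bigr => i _ do rewrite mulrCA; rewrite -mulr_sumr sum_irr1_mul.
    case: eqP => [hqp|_]; last by rewrite muln0 mulr0.
    by rewrite (Hn_row_col_even dt Hh Cq Rp hqp) mul1r.
  move/eqP; rewrite psumr_eq0 => [/allP/(_ 1%g)|h _]; last by do 2!apply: sumr_ge0 => ? _; apply: ler0n.
  rewrite mem_index_enum group1 => /(_ isT)/=.
  rewrite psumr_eq0 => [/allP/(_ 1%g)|h _]; last by apply: sumr_ge0 => ? _; apply: ler0n.
  rewrite mem_index_enum group1 => /(_ isT)/=.
  rewrite psumr_eq0 => [/allP/(_ 1%g)|h _]; last by apply: ler0n.
  rewrite mem_index_enum group1 => /(_ isT)/=.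
  by rewrite !mulg1 eqxx muln1 (negPf (neq0CG _)).
exists i; split; apply: contraNneq Si => z0; apply/eqP; rewrite /S.
- rewrite big1 // => h _; rewrite big1 // => q _; rewrite -mulr_sumr.
  under eq_bigr => p _ do rewrite irr_mulC.
  by rewrite group_sum_eq0 // mulr0.
- rewrite big1 // => h _; rewrite exchange_big big1 // => p _.
  under eq_bigr => q _ do rewrite -mulgA irr_mulC -mulgA.
  by rewrite col_sum_eq0.
- rewrite exchange_big big1 // => q _; rewrite exchange_big big1 // => p _.
  by rewrite -mulr_sumr; under eq_bigr => h _ do rewrite -mulgA; rewrite group_sum_eq0 ?mulr0.
Qed.

End Hyperoctahedral.

(** * Cycle types and double cosets *)

Definition two_rel (T : finType) (a b : T -> T) := [rel x y | (y == a x) || (y == b x)].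

Section TwoInvolutions.
Variables (T : finType) (a b : T -> T).
Hypotheses (aK : involutive a) (bK : involutive b).
Hypotheses (a_neq : forall x, a x != x) (b_neq : forall x, b x != x).
Local Notation p := (b \o a).
Local Notation R := (two_rel a b).

Lemma two_inv_inj : injective p.
Proof. exact: inj_comp (can_inj bK) (can_inj aK). Qed.

Lemma two_inv_swap x : p (a (p x)) = a x.
Proof. by rewrite /= aK bK. Qed.

Lemma two_inv_iter_swap i x : iter i p (a (iter i p x)) = a x.
Proof. by elim: i x => // i IH x; rewrite [iter i.+1 p x]iterS iterSr two_inv_swap IH. Qed.

(** If the k-th iterate sent x to [a x], the point halfway would give a fixed point of [a] (k even)
    or of [b] (k odd). Hence each cycle of the union of two matchings splits into two orbits of
    [b \o a]. *)
Lemma two_inv_split x : ~~ fconnect p x (a x).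
Proof.
apply/negP => /iter_findex; set k := findex _ _ _.
have iterI i : injective (iter i p).
  by elim: i => // i IH; apply: inj_comp two_inv_inj IH.
rewrite -(odd_double_half k) -addnn !iterD -[RHS](two_inv_iter_swap k./2 x).
set z := iter k./2 p x; case: (odd k) => /=.
  have -> : b (a (iter k./2 p z)) = iter k./2 p (p z) by rewrite -iterSr.
  by move=> /iterI /= bz; have := b_neq (a z); rewrite bz eqxx.
by move=> /iterI az; have := a_neq z; rewrite -az eqxx.
Qed.

Lemma two_rel_sym : connect_sym R.
Proof.
apply: sym_connect_sym => x y; rewrite /two_rel /=.
by rewrite ![y == _]eq_sym (inv_eq aK) (inv_eq bK).
Qed.

Lemma connect_two_rel x y : connect R x y = fconnect p x y || fconnect p x (a y).
Proof.
have R_p u v : fconnect p u v -> connect R u v.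
  move=> /iter_findex <-; elim: (findex _ _ _) => //= i IH.
  apply: connect_trans IH _; set z := iter i p u.
  apply: (@connect_trans _ _ (a z)); apply: connect1; first by rewrite /= eqxx.
  by rewrite /= eqxx orbT.
apply/idP/orP => [|[/R_p//|/R_p xy]]; last first.
  by apply: connect_trans xy (connect1 _); rewrite /= aK eqxx.
pose S := [pred y | fconnect p x y || fconnect p x (a y)].
have clS : closed R S.
  move=> u v /orP[] /eqP ->; rewrite !inE; first by rewrite aK orbC.
  have -> : b u = p (a u) by rewrite /= aK.
  rewrite -(same_fconnect1_r two_inv_inj x (a u)) orbC; congr (_ || _).
  by rewrite [RHS](same_fconnect1_r two_inv_inj) two_inv_swap aK.
by move=> /(closed_connect clS); rewrite !inE connect0 => /esym/orP.
Qed.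

(** Accounts for the halving in [ctype]: each part of the cycle type is the order of a point under
    [b \o a]. *)
Lemma card_two_rel x : #|[pred y | connect R x y]| = (fingraph.order p x).*2.
Proof.
rewrite -(cardID (fconnect p x)) -addnn; congr (_ + _).
  by apply: eq_card => y; rewrite !inE ?unfold_in connect_two_rel; case: (fconnect p x y); rewrite ?andbF.
rewrite /fingraph.order -(card_imset _ (can_inj aK)); apply: eq_card => y; rewrite !inE ?unfold_in.
rewrite connect_two_rel; apply/idP/imsetP => [|[z]].
  by case: (fconnect p x y) => //= xay; exists (a y); rewrite ?aK.
rewrite inE ?unfold_in => xz ->; rewrite aK xz orbT andbT.
apply: contra (two_inv_split z) => xaz.
by rewrite (connect_trans _ xaz) // (fconnect_sym two_inv_inj).
Qed.

Lemma sum_order_roots : \sum_(x in roots R) (fingraph.order p x).*2 = #|T|.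
Proof.
rewrite -sum1_card [RHS](partition_big (fingraph.root R) (mem (roots R))) => [|x _].
  apply: eq_bigr => x Rx; rewrite -card_two_rel -sum1_card; apply: eq_bigl => y.
  have /eqP root_x : fingraph.root R x == x := Rx.
  by rewrite !inE -(root_connect two_rel_sym) root_x eq_sym.
exact: roots_root two_rel_sym _.
Qed.

End TwoInvolutions.

Lemma iter_mod_order (T : finType) (f : T -> T) (fI : injective f) i x :
  iter i f x = iter (i %% fingraph.order f x) f x.
Proof.
rewrite {1}(divn_eq i (fingraph.order f x)) addnC iterD; congr (iter _ f _).
by elim: (i %/ _) => //= k IH; rewrite mulSn iterD IH iter_order.
Qed.

(** * Isomorphism between two unions of matchings with the same cycle lengths *)

Section Transport.
Variables (m : nat) (a b1 b2 : 'I_m -> 'I_m).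
Hypotheses (aK : involutive a) (b1K : involutive b1) (b2K : involutive b2).
Hypotheses (a_neq : forall x, a x != x) (b1_neq : forall x, b1 x != x)
  (b2_neq : forall x, b2 x != x).
Local Notation p1 := (b1 \o a).
Local Notation p2 := (b2 \o a).
Local Notation R1 := (two_rel a b1).
Local Notation R2 := (two_rel a b2).
Variable g : {perm 'I_m}.
Hypothesis gR : forall x, (g x \in roots R2) = (x \in roots R1).
Hypothesis g_order : forall x, x \in roots R1 -> fingraph.order p2 (g x) = fingraph.order p1 x.

(** Follows the orbit of the root x in step with the orbit of [g x], and reaches the other half of
    the component through [a]. *)
Definition transport (y : 'I_m) : 'I_m :=
  let x := fingraph.root R1 y in
  if fconnect p1 x y then iter (findex p1 x y) p2 (g x)
  else a (iter (findex p1 x (a y)) p2 (g x)).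

Let p1I : injective p1 := two_inv_inj aK b1K.
Let p2I : injective p2 := two_inv_inj aK b2K.

Lemma transport_iter x i : x \in roots R1 ->
  transport (iter i p1 x) = iter i p2 (g x) /\
  transport (a (iter i p1 x)) = a (iter i p2 (g x)).
Proof.
move=> Rx; have symR := two_rel_sym aK b1K.
have cx : connect R1 x (iter i p1 x).
  by rewrite (connect_two_rel aK b1K) fconnect_iter.
have root_x : fingraph.root R1 (iter i p1 x) = x.
  have /eqP root_xx : fingraph.root R1 x == x := Rx.
  by rewrite -[RHS]root_xx; apply/esym/(fingraph.rootP symR).
have root_ax : fingraph.root R1 (a (iter i p1 x)) = x.
  rewrite -[RHS]root_x; apply/esym/(fingraph.rootP symR); apply: connect1.
  by rewrite /= eqxx.
have idx : iter (findex p1 x (iter i p1 x)) p2 (g x) = iter i p2 (g x).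
  rewrite (iter_mod_order p1I) findex_iter ?ltn_pmod ?fingraph.order_gt0 //.
  by rewrite [RHS](iter_mod_order p2I) g_order.
split; rewrite /transport ?root_x ?root_ax; first by rewrite fconnect_iter.
rewrite aK; case: ifP => [xax|_]; last by rewrite idx.
case/negP: (two_inv_split aK b1K a_neq b1_neq (iter i p1 x)).
by rewrite (connect_trans _ xax) // fconnect_sym // fconnect_iter.
Qed.

Lemma two_rel_param (b : 'I_m -> 'I_m) (bK : involutive b) (y : 'I_m) :
  exists i, exists2 x, x \in roots (two_rel a b) &
    y = iter i (b \o a) x \/ y = a (iter i (b \o a) x).
Proof.
have symR := two_rel_sym aK bK; set x := fingraph.root (two_rel a b) y.
have Rx : x \in roots (two_rel a b) by apply: roots_root.
have : connect (two_rel a b) x y by rewrite symR connect_root.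
rewrite (connect_two_rel aK bK) => /orP[] /iter_findex e.
  by exists (findex (b \o a) x y), x => //; left.
by exists (findex (b \o a) x (a y)), x => //; right; rewrite e aK.
Qed.

Lemma transport_a y : transport (a y) = a (transport y).
Proof.
have [i [x Rx [->|->]]] := two_rel_param b1K y; have [e1 e2] := transport_iter i Rx.
  by rewrite e1 e2.
by rewrite aK e1 e2 aK.
Qed.

Lemma transport_p y : transport (p1 y) = p2 (transport y).
Proof.
have [i [x Rx [->|->]]] := two_rel_param b1K y.
  have [-> _] := transport_iter i Rx.
  by rewrite -iterS; have [-> _] := transport_iter i.+1 Rx.
(* On the half reached through [a] the map [p1] runs backwards; adding a full period provides a
   predecessor even when i is 0. *)
pose k := (i + fingraph.order p1 x).-1.
have kE : k.+1 = i + fingraph.order p1 x by rewrite prednK // addn_gt0 fingraph.order_gt0 orbT.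
have -> : iter i p1 x = iter k.+1 p1 x by rewrite kE iterD iter_order.
have [_ ->] := transport_iter k.+1 Rx; rewrite !iterS !two_inv_swap //.
by have [_ ->] := transport_iter k Rx.
Qed.

Lemma transport_b y : transport (b1 y) = b2 (transport y).
Proof. by rewrite -{1}(aK y) [LHS]transport_p transport_a /= aK. Qed.

Lemma transport_inj : injective transport.
Proof.
have sur z : exists y, transport y == z.
  have [i [x' Rx' zE]] := two_rel_param b2K z.
  have Rx : (g^-1)%g x' \in roots R1 by rewrite -gR permKV.
  have [e1 e2] := transport_iter i Rx; rewrite permKV in e1 e2.
  by case: zE => ->; [exists (iter i p1 ((g^-1)%g x')) | exists (a (iter i p1 ((g^-1)%g x')))];
     apply/eqP.
pose k z := xchoose (sur z).
have kK : cancel k transport by move=> z; apply/eqP/(xchooseP (sur z)).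
exact: bij_inj (bij_can_bij (injF_bij (can_inj kK)) kK).
Qed.

End Transport.

(** * The cycle type determines the double coset *)

Section CycleType.
Variable n : nat.
Local Notation T := 'I_(n.*2).
Local Notation gT := {perm T}.
Implicit Types s t h : gT.

Definition img s : T -> T := Defs.mact s (@mstar n).
Definition stype s := ctype (@mstar n) (img s).
Local Notation rho s := (img s \o @mstar n).

Lemma imgK s : involutive (img s).
Proof. by move=> x; rewrite /img /Defs.mact permK mstarK permKV. Qed.

Lemma img_neq s x : img s x != x.
Proof.
by rewrite /img /Defs.mact -{2}(permKV s x) (inj_eq perm_inj) mstar_neq.
Qed.

Lemma stypeE s :
  stype s = sort geq
    [seq fingraph.order (rho s) x | x <- enum (roots (two_rel (@mstar n) (img s)))].
Proof.
rewrite /stype /ctype; congr (sort geq _); apply: eq_map => x.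
by rewrite -[RHS]doubleK -(card_two_rel (@mstarK n) (@imgK s) (@mstar_neq n) (@img_neq s)).
Qed.

Lemma stype_perm s : perm_eq (stype s)
  [seq fingraph.order (rho s) x | x <- enum (roots (two_rel (@mstar n) (img s)))].
Proof. by rewrite stypeE perm_sort. Qed.

Lemma stype_partition s : stype s \in partitions n.
Proof.
apply/partitionsP; split.
- by rewrite stypeE sort_sorted // => x y; rewrite /geq; apply: leq_total.
- by rewrite (perm_all _ (stype_perm s)) all_map; apply/allP => x _; apply: fingraph.order_gt0.
- rewrite (perm_sumn (stype_perm s)) sumnE big_map big_enum /=.
  apply: double_inj; rewrite -[RHS]card_ord.
  rewrite -(sum_order_roots (@mstarK n) (@imgK s) (@mstar_neq n) (@img_neq s)).
  by rewrite (big_morph double doubleD (erefl 0.*2)).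
Qed.

(** Equal cycle types give a permutation matching roots of equal order; [transport] extends it to
    some k fixing m* and carrying the matching of s to that of t. *)
Lemma stype_double_coset s t : stype s = stype t ->
  exists h k, [/\ h \in Hn n, k \in Hn n & t = (h * s * k)%g].
Proof.
move=> eq_st.
pose R s := two_rel (@mstar n) (img s).
(* Orders are positive, so the value 0 marks exactly the points that are not roots. *)
pose f s x := if x \in roots (R s) then fingraph.order (rho s) x else 0.
have cardf u v : #|[pred x | f u x == v]| =
    if v == 0 then #|T| - size (stype u) else count_mem v (stype u).
  have stp := stype_perm u; case: eqP => [->|/eqP v0].
    rewrite (perm_size stp) size_map -cardE -(cardC (roots (R u))) addKn.
    apply: eq_card => x; rewrite !inE /f -[roots _ _]/(x \in roots (R u)).
    case: ifP => // _.
    by rewrite gtn_eqF ?fingraph.order_gt0.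
  rewrite (seq.permP stp) count_map cardE /enum_mem size_filter count_filter.
  apply: eq_count => x /=; rewrite !inE /f -/(R u).
  rewrite -[roots _ _]/(x \in roots (R u)).
  by case: ifP => [_|_]; rewrite ?andbT ?andbF // eq_sym (negPf v0).
have eq_card_st v : #|[pred x | f s x == v]| = #|[pred x | f t x == v]|.
  by rewrite (cardf s) (cardf t) eq_st.
have [g gE] := fiber_perm eq_card_st.
have gR x : (g x \in roots (R t)) = (x \in roots (R s)).
  move: (gE x); rewrite /f; case: (_ \in _); case: (_ \in _) => // e.
    by have := fingraph.order_gt0 (rho t) (g x); rewrite e.
  by have := fingraph.order_gt0 (rho s) x; rewrite -e.
have g_ord x : x \in roots (R s) -> fingraph.order (rho t) (g x) = fingraph.order (rho s) x.
  by move=> Rx; move: (gE x); rewrite /f gR Rx.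
pose H := transport (@mstar n) (img s) (img t) g.
have [[mK sK] tK] := (@mstarK n, @imgK s, @imgK t).
have [m_neq s_neq] := (@mstar_neq n, @img_neq s).
have HI : injective H by apply: transport_inj.
have Hm x : H (mstar x) = mstar (H x) by apply: transport_a.
have Hb x : H (img s x) = img t (H x) by apply: transport_b.
pose k : gT := perm HI.
exists (t * k^-1 * s^-1)%g, k; split; last by rewrite !mulgKV.
  rewrite -groupV !invMg !invgK; apply/HnP => x; rewrite !permM ![k _]permE.
  have := Hb (s x); rewrite /img /Defs.mact permK => ->.
  by rewrite permK.
by apply/HnP => x; rewrite !permE.
Qed.

End CycleType.

(** * Cycle types met by a Young subgroup *)

Section CycleTypeYoung.
Variable n : nat.
Local Notation T := 'I_(n.*2).
Local Notation gT := {perm T}.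
Implicit Types s t h : gT.
Local Notation R s := (two_rel (@mstar n) (img s)).
Local Notation rho s := (img s \o @mstar n).

Lemma connect_row (r : T -> nat) s x y :
    (forall x, r (mstar x) = r x) -> s \in fiber_stab r ->
  connect (R s) x y -> r x = r y.
Proof.
move=> rm /fiber_stabP rs.
have clr : closed (R s) [pred y | r y == r x].
  move=> u v /orP[] /eqP ->; rewrite !inE ?rm // /img /Defs.mact.
  by rewrite rs rm -(rs ((s^-1)%g u)) permKV.
by move=> /(closed_connect clr); rewrite !inE eqxx => /esym/eqP.
Qed.

Lemma sum_subn_leq (I : finType) (P : pred I) (F : I -> nat) (t : nat) :
  \sum_(x | P x) (F x - t) <= (\sum_(x | P x) F x) - t.
Proof.
by elim/big_ind2: _ => // [a1 b1 a2 b2]; lia.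
Qed.

(** Every cycle stays within one row, so the cycle type refines [mu]; grouping parts by row and
    merging each group can only increase truncated sums. *)
Lemma stype_refines mu (r c : T -> nat) s (t : nat) : doubled_tableau mu r c ->
  s \in fiber_stab r -> tail_sum t (stype s) <= tail_sum t mu.
Proof.
move=> [tab rm cm] Rs; have symR := two_rel_sym (@mstarK n) (@imgK n s).
rewrite [leqLHS](perm_sumn (perm_map (subn^~ t) (stype_perm s))) -map_comp sumnE.
rewrite big_map big_enum /= tail_sum_nth.
have lt_r x : r x < size mu by have := tableau_row tab x; rewrite size_map.
pose r' x := Ordinal (lt_r x).
rewrite (partition_big r' predT) //=; apply: leq_sum => i _.
apply: leq_trans (sum_subn_leq _ _ _) _; apply: leq_sub2r.
rewrite -leq_double -[leqRHS]mul2n -nth_doublep -(tableau_card_row_all tab).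
rewrite (big_morph double doubleD (erefl 0.*2)) -sum1_card.
rewrite [leqRHS](partition_big (fingraph.root (R s)) [pred x | (x \in roots (R s)) && (r' x == i)]).
  apply/eq_leq/eq_bigr => x /andP[Rx /eqP rx].
  have /eqP root_x : fingraph.root (R s) x == x := Rx.
  rewrite -(card_two_rel (@mstarK n) (@imgK n s) (@mstar_neq n) (@img_neq n s)).
  rewrite -sum1_card; apply: eq_bigl => y.
  rewrite !inE; apply/idP/andP => [cxy|[_ /eqP <-]]; last by rewrite symR connect_root.
  split; last by apply/eqP; rewrite -root_x; apply/esym/(fingraph.rootP symR).
  by rewrite -(connect_row rm Rs cxy) -[r x]/(val (r' x)) rx eqxx.
move=> x; rewrite !inE => /eqP rx; apply/andP; split; first exact: (roots_root symR).
rewrite -val_eqE /= -rx; apply/eqP/esym; apply: connect_row rm Rs _.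
exact: connect_root.
Qed.

Section Shift.
Variables (mu : seq nat) (r c : T -> nat).
Hypothesis dt : doubled_tableau mu r c.

Lemma row_shift_exists x : exists y,
  (r y == r x) && (c y == (c x).+1 %% nth 0 (doublep mu) (r x)).
Proof.
have [[ltc inj sur] rm cm] := dt.
have [|y [ry cy]] := sur (r x) ((c x).+1 %% nth 0 (doublep mu) (r x)).
  by rewrite ltn_mod (leq_ltn_trans _ (ltc x)).
by exists y; rewrite ry cy !eqxx.
Qed.

(** Rotates every row by one column. The shifted matching joins columns 2j+1 and 2j+2 cyclically, so
    with m* it makes each row a single cycle; this realizes the cycle type [mu] inside the Young
    subgroup. *)
Definition row_shift_fun x := xchoose (row_shift_exists x).

Lemma row_shift_funP x : r (row_shift_fun x) = r x /\
  c (row_shift_fun x) = (c x).+1 %% nth 0 (doublep mu) (r x).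
Proof. by have /andP[/eqP rE /eqP cE] := xchooseP (row_shift_exists x). Qed.

Lemma row_shift_inj : injective row_shift_fun.
Proof.
have [[ltc inj sur] rm cm] := dt.
move=> x y e; have [rx cx] := row_shift_funP x; have [ry cy] := row_shift_funP y.
have rxy : r x = r y by rewrite -rx -ry e.
apply: inj => //; have /eqP : (c x).+1 %% nth 0 (doublep mu) (r x) = (c y).+1 %% nth 0 (doublep mu) (r x).
  by rewrite -cx rxy -cy e.
rewrite -[(c x).+1]addn1 -[(c y).+1]addn1 eqn_modDr !modn_small ?ltc // => [/eqP//|].
by rewrite rxy ltc.
Qed.

Definition row_shift : gT := perm row_shift_inj.

Lemma row_shift_row x : r (row_shift x) = r x.
Proof. by rewrite permE; case: (row_shift_funP x). Qed.

Lemma row_shift_col x : c (row_shift x) = (c x).+1 %% nth 0 (doublep mu) (r x).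
Proof. by rewrite permE; case: (row_shift_funP x). Qed.

Lemma row_shift_stab : row_shift \in fiber_stab r.
Proof. exact/fiber_stabP/row_shift_row. Qed.

Lemma row_shift_even x : ~~ odd (c x) -> row_shift x = mstar x.
Proof.
have [[ltc inj sur] rm cm] := dt => ev; apply: inj; first by rewrite row_shift_row rm.
have cmx : c (mstar x) = (c x).+1 by rewrite cm /flip (negPf ev).
by rewrite row_shift_col cmx modn_small // -cmx -rm ltc.
Qed.

Lemma img_row_shift x : img row_shift (row_shift x) = row_shift (mstar x).
Proof. by rewrite /img /Defs.mact permK. Qed.

Lemma connect_row_shift x : connect (R row_shift) x (row_shift x).
Proof.
have [_ rm cm] := dt; apply: connect1; rewrite /two_rel /=.
have [od|ev] := boolP (odd (c x)); last by rewrite row_shift_even ?eqxx.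
have e : row_shift (mstar x) = x by rewrite row_shift_even ?mstarK // cm odd_flip od.
by rewrite -{4}e img_row_shift mstarK eqxx orbT.
Qed.

Lemma connect_row_shiftE x y : connect (R row_shift) x y = (r x == r y).
Proof.
have [[ltc inj sur] rm cm] := dt.
apply/idP/eqP => [|rxy]; first exact: connect_row rm row_shift_stab.
set N := nth 0 (doublep mu) (r x).
have it k : connect (R row_shift) x (iter k row_shift x) /\
   (r (iter k row_shift x) = r x /\ c (iter k row_shift x) = (c x + k) %% N).
  elim: k => [|k [IHx [IHr IHc]]]; first by rewrite /= addn0 modn_small ?connect0 ?ltc.
  rewrite iterS row_shift_row row_shift_col IHr IHc; split.
    exact: connect_trans IHx (connect_row_shift _).
  by split=> //; rewrite -/N -addn1 modnDml addn1 addnS.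
(* Chosen so that the column reached is [c y + N] modulo N, avoiding a truncated difference of
   columns. *)
have [xk [rk ck]] := it (c y + (N - c x)).
suff <- : iter (c y + (N - c x)) row_shift x = y by [].
apply: inj; first by rewrite rk.
have := ltc x; rewrite -/N ck => lt_x.
have -> : c x + (c y + (N - c x)) = c y + N by lia.
by rewrite modnDr modn_small // /N rxy ltc.
Qed.

Lemma row_shift_stype : sorted geq mu -> all (ltn 0) mu -> stype row_shift = mu.
Proof.
move=> smu mu0; have [tab rm cm] := dt; have [ltc inj sur] := tab.
have symR := two_rel_sym (@mstarK n) (@imgK n row_shift).
have ordE x : fingraph.order (rho row_shift) x = nth 0 mu (r x).
  apply: double_inj; rewrite -[RHS]mul2n -nth_doublep -(tableau_card_row_all tab).
  rewrite -(card_two_rel (@mstarK n) (@imgK n row_shift) (@mstar_neq n) (@img_neq n row_shift)).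
  by apply: eq_card => y; rewrite !inE connect_row_shiftE eq_sym.
have geq_tot : total geq by move=> a b; apply: leq_total.
have geq_tr : transitive geq by move=> a b d ba db; apply: leq_trans db ba.
have geq_anti : antisymmetric geq by move=> a b; rewrite andbC; apply: anti_leq.
rewrite -[RHS](sorted_sort geq_tr smu) stypeE.
apply/(perm_sortP geq_tot geq_tr geq_anti).
rewrite (eq_map ordE) (map_comp (nth 0 mu) r) -[mu in X in perm_eq _ X](mkseq_nth 0).
apply: perm_map; apply: uniq_perm; rewrite ?iota_uniq //.
  rewrite map_inj_in_uniq ?enum_uniq // => x y; rewrite !mem_enum => Rx Ry rxy.
  have /eqP root_x : fingraph.root (R row_shift) x == x := Rx.
  have /eqP root_y : fingraph.root (R row_shift) y == y := Ry.
  by rewrite -root_x -root_y; apply/(fingraph.rootP symR); rewrite connect_row_shiftE rxy.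
move=> i; rewrite mem_iota add0n /=; apply/mapP/idP => [[x _ ->]|lti].
  by have := tableau_row tab x; rewrite size_map.
have [|x [rx _]] := sur i 0.
  by rewrite nth_doublep muln_gt0 /=; apply: (allP mu0); apply: mem_nth.
exists (fingraph.root (R row_shift) x); first by rewrite mem_enum; apply: roots_root.
by apply/eqP; rewrite -rx -connect_row_shiftE connect_root.
Qed.

End Shift.

End CycleTypeYoung.

(** * The zonal table *)

Section ZonalCharacters.
Local Open Scope ring_scope.
Variable n : nat.
Local Notation T := 'I_(n.*2).
Local Notation gT := {perm T}.
Local Notation G := [set: gT].
Local Notation yrow la := (yblock (doublep la) : T -> nat).

Definition zirr (la : seq nat) : Iirr G := irr_index n.*2 (doublep la).

Lemma sorted_doublep la : sorted geq la -> sorted geq (doublep la).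
Proof.
move=> sla; rewrite /doublep sorted_map; apply: sub_sorted sla => x y /=.
by rewrite leq_pmul2l.
Qed.

(** The irreducible character from [doubled_irr_exists] passes the test in [irr_index], so its
    default is never taken, and [young_irr_uniq] identifies it with the chosen one. *)
Lemma zirrP la : la \in partitions n ->
  [/\ row_sum (zirr la) (yrow la) != 0,
      col_sum (zirr la) (yoffset (doublep la) : T -> nat) != 0
    & Hn_sum (zirr la) != 0].
Proof.
case/partitionsP=> sla la0 sum_la; have dt := doubled_yblock sum_la.
have [i [ri ci Hi]] := doubled_irr_exists dt.
have [tab _ _] := dt.
have [g gE] := yblock_conjp tab (sorted_doublep sla).
suff -> : zirr la = i by [].
rewrite /zirr /irr_index; case: pickP => [j|/(_ i)] /=; last first.
  by rewrite permchar_neq0 sgn_permchar_neq0 ri (col_sum_conj _ gE) ci.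
rewrite permchar_neq0 sgn_permchar_neq0 (col_sum_conj _ gE) => /andP[rj cj].
exact: young_irr_uniq tab rj cj ri ci.
Qed.

Lemma tail_sum_doublep t mu : tail_sum (2 * t) (doublep mu) = (2 * tail_sum t mu)%N.
Proof. by rewrite /tail_sum; elim: mu => //= k mu ->; lia. Qed.

(** [young_pair_inj] places rows of 2 mu against columns of 2 la with no repeated pair, which forces
    dominance. Even thresholds suffice, by [tail_sum_doublep]. *)
Lemma zirr_row_lexle la mu : la \in partitions n -> mu \in partitions n ->
  row_sum (zirr la) (yrow mu) != 0 -> lexle mu la.
Proof.
move=> Pla Pmu rmu; have [_ cla _] := zirrP Pla.
case/partitionsP: (Pla) => sla la0 sum_la; case/partitionsP: (Pmu) => smu mu0 sum_mu.
have [tab_la _ _] := doubled_yblock sum_la; have [tab_mu _ _] := doubled_yblock sum_mu.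
have [g [inj _]] := young_pair_inj rmu cla.
apply: lexle_tail_sum => // t.
rewrite -(leq_pmul2l (isT : 0 < 2)%N) -!tail_sum_doublep -(tableau_card_tail tab_la).
apply: (tail_sum_le_card (f := fun x => yrow mu (g x))) => //.
  by move=> x; apply: tableau_row tab_mu _.
move=> k; rewrite -(tableau_card_row_all tab_mu).
rewrite -(card_imset _ (@perm_inj _ g)); apply: eq_card => y; rewrite !inE.
apply/imsetP/idP => [[x + ->]|ry]; first by rewrite inE.
by exists ((g^-1)%g y); rewrite ?inE permKV.
Qed.

Lemma zirr_inj la mu : la \in partitions n -> mu \in partitions n ->
  zirr la = zirr mu -> la = mu.
Proof.
move=> Pla Pmu e; apply: lexle_anti; apply: zirr_row_lexle => //.
  by rewrite -e; case: (zirrP Pla).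
by rewrite e; case: (zirrP Pmu).
Qed.

Lemma card_Hn_neq0 : #|Hn n|%:R != 0 :> algC.
Proof. exact: (neq0CG (Hn_group n)). Qed.

Definition biinvariant (F : gT -> algC) :=
  forall h k s, h \in Hn n -> k \in Hn n -> F (h * s * k)%g = F s.

Lemma biinvariant_stype F s t : biinvariant F -> stype s = stype t -> F s = F t.
Proof. by move=> biF /stype_double_coset[h [k [Hh Hk ->]]]; rewrite biF. Qed.

Lemma omegaE la s :
  omega la s = #|Hn n|%:R^-1 * \sum_(h in Hn n) 'chi_(zirr la) (h * s^-1)%g.
Proof. by []. Qed.

Lemma omega_biinvariant la : biinvariant (omega la).
Proof.
move=> h k s Hh Hk; rewrite !omegaE; congr (_ * _).
rewrite (reindex_inj (mulgI h)%g) /= (reindex_inj (mulIg k)%g) /=.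
apply: eq_big => [x|x _]; first by rewrite groupMl ?groupMr.
by rewrite !invMg !mulgA mulgK [LHS]irr_mulC !mulgA mulVg mul1g.
Qed.

Definition gdot (F F' : gT -> algC) := \sum_s F s * (F' s)^*.

Lemma omega_orthogonality la mu : gdot (omega la) (omega mu) =
  (zirr la == zirr mu)%:R * (irr_ratio (zirr la) * (#|Hn n|%:R^-1 * Hn_sum (zirr la))).
Proof.
rewrite /gdot (reindex_inj invg_inj) /=.
transitivity (#|Hn n|%:R^-1 ^+ 2 * \sum_(h in Hn n) \sum_(k in Hn n)
   (zirr la == zirr mu)%:R * irr_ratio (zirr la) * 'chi_(zirr la) (h * k^-1)%g).
  under eq_bigr => s _.
    rewrite !omegaE rmorphM fmorphV rmorph_nat mulrACA -expr2 rmorph_sum big_distrlr /=.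
    rewrite invgK; over.
  rewrite -mulr_sumr exchange_big; congr (_ * _); apply: eq_bigr => h _ /=.
  by rewrite exchange_big; apply: eq_bigr => k _ /=; rewrite irr_orthogonality.
transitivity (#|Hn n|%:R^-1 ^+ 2 * \sum_(h in Hn n)
   (zirr la == zirr mu)%:R * irr_ratio (zirr la) * Hn_sum (zirr la)).
  congr (_ * _); rewrite exchange_big; apply: eq_bigr => k Hk /=; rewrite -mulr_sumr; congr (_ * _).
  rewrite [RHS](reindex_inj (mulIg k^-1)%g); apply: eq_bigl => h.
  by rewrite groupMr ?groupV.
rewrite sumr_const -[(_ * Hn_sum _) *+ _]mulr_natr expr2.
move: card_Hn_neq0 (irr_ratio _) (Hn_sum _) (_ == _); move: (#|_|%:R) => c c0 a b d.
by field.
Qed.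

(** The choice made in [zonal], so that [zonal n la rho] is [omega la (rep rho)] by conversion. *)
Definition rep (rho : seq nat) : gT := odflt 1%g [pick s : gT | stype s == rho].

Lemma stype_rep rho : rho \in partitions n -> stype (rep rho) = rho.
Proof.
case/partitionsP=> srho rho0 sum_rho; rewrite /rep; case: pickP => [s /eqP //|].
by move=> /(_ (row_shift (doubled_yblock sum_rho))); rewrite row_shift_stype ?eqxx.
Qed.

Lemma omega_norm_neq0 la : la \in partitions n -> gdot (omega la) (omega la) != 0.
Proof.
move=> Pla; have [_ _ Hla] := zirrP Pla.
rewrite omega_orthogonality eqxx mul1r mulf_neq0 ?irr_ratio_neq0 // mulf_neq0 //.
by rewrite invr_eq0 card_Hn_neq0.
Qed.

(** Orthogonality gives the square matrix [Om] a right inverse [M]; being also a left inverse, it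
    yields the expansion. *)
Lemma omega_complete (F : gT -> algC) (lam := nth [::] (partitions n)) s :
    (forall s t, stype s = stype t -> F s = F t) ->
  F s = \sum_(l < size (partitions n))
    gdot F (omega (lam l)) / gdot (omega (lam l)) (omega (lam l)) * omega (lam l) s.
Proof.
move=> stF; set N := size _.
have Plam (l : 'I_N) : lam l \in partitions n by apply: mem_nth.
pose D rho : algC := #|[pred t : gT | stype t == rho]|%:R.
have gdotE F1 F2 : (forall s t, stype s = stype t -> F1 s = F1 t) ->
    (forall s t, stype s = stype t -> F2 s = F2 t) ->
    gdot F1 F2 = \sum_(j < N) D (lam j) * (F1 (rep (lam j)) * (F2 (rep (lam j)))^*).
  move=> st1 st2; rewrite /gdot.
  have lt_idx (t : gT) : (index (stype t) (partitions n) < N)%N.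
    by rewrite index_mem stype_partition.
  pose ix t := Ordinal (lt_idx t).
  have ixE t j : (ix t == j) = (stype t == lam j).
    apply/eqP/eqP => [<-|e]; first by rewrite /lam /= nth_index ?stype_partition.
    by apply: val_inj; rewrite /= e /lam index_uniq ?partitions_uniq.
  rewrite (partition_big ix predT) //=; apply: eq_bigr => j _.
  rewrite mulr_natl -sumr_const; apply: eq_big => [t|t].
    by rewrite inE ixE.
  rewrite ixE => /eqP tj.
  have e : stype t = stype (rep (lam j)) by rewrite stype_rep.
  by rewrite (st1 _ _ e) (st2 _ _ e).
have st_om la (t u : gT) : stype t = stype u -> omega la t = omega la u.
  by apply: biinvariant_stype; apply: omega_biinvariant.
pose Om := \matrix_(l < N, j < N) omega (lam l) (rep (lam j)).
(* The conjugate transpose of [Om], weighted by double coset sizes and divided by the squared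
   norms. *)
pose M := \matrix_(j < N, l < N)
   (D (lam j) * (omega (lam l) (rep (lam j)))^* / gdot (omega (lam l)) (omega (lam l))).
have OmM : Om *m M = 1%:M.
  apply/matrixP => l l'; rewrite !mxE.
  transitivity (gdot (omega (lam l)) (omega (lam l')) / gdot (omega (lam l')) (omega (lam l'))).
    rewrite (gdotE _ _ (st_om _) (st_om _)) big_distrl /=; apply: eq_bigr => j _.
    by rewrite !mxE mulrA mulrCA mulrA.
  have [->|ne_l] := eqVneq l l'; first by rewrite divff ?omega_norm_neq0.
  rewrite omega_orthogonality; case: eqP => [/zirr_inj|_]; last by rewrite !mul0r.
  move=> /(_ (Plam l) (Plam l')) /eqP; rewrite nth_uniq ?partitions_uniq // => e.
  by rewrite val_eqE (negPf ne_l) in e.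
have MOm := mulmx1C OmM.
have lt_idx : (index (stype s) (partitions n) < N)%N by rewrite index_mem stype_partition.
pose j0 := Ordinal lt_idx.
have lam_j0 : lam j0 = stype s by rewrite /lam nth_index ?stype_partition.
have e : stype s = stype (rep (lam j0)) by rewrite stype_rep ?lam_j0 ?stype_partition.
pose f := \row_(j < N) F (rep (lam j)).
have : (f *m M *m Om) 0 j0 = f 0 j0 by rewrite -mulmxA MOm mulmx1.
rewrite [RHS]mxE (stF _ _ e) => <-; rewrite mxE; apply: eq_bigr => l _.
rewrite (st_om _ _ _ e) [Om _ _]mxE; congr (_ * _).
rewrite mxE (gdotE _ _ stF (st_om _)) big_distrl /=; apply: eq_bigr => j _.
by rewrite !mxE mulrA mulrCA mulrA.
Qed.

End ZonalCharacters.

Local Open Scope ring_scope.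

(** * Triangular factorization and leading principal minors *)

Section Triangularity.
Variable n : nat.
Local Notation T := 'I_(n.*2).
Local Notation gT := {perm T}.
Local Notation N := (size (partitions n)).
Local Notation lam := (nth [::] (partitions n)).
Local Notation yrow la := (yblock (doublep la) : T -> nat).

(** The function phi_mu of the overview. *)
Definition young_density mu (s : gT) : algC :=
  #|[pred t in fiber_stab (yrow mu) | stype t == stype s]|%:R
    / #|[pred t : gT | stype t == stype s]|%:R.

Lemma young_density_stype mu (s t : gT) :
  stype s = stype t -> young_density mu s = young_density mu t.
Proof. by rewrite /young_density => ->. Qed.

Lemma young_density_neq0 mu (s : gT) : (young_density mu s != 0) =
  [exists t in fiber_stab (yrow mu), stype t == stype s].
Proof.
have card_neq0 : #|[pred t : gT | stype t == stype s]| != 0%N.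
  by rewrite -lt0n; apply/card_gt0P; exists s; rewrite inE.
rewrite /young_density mulf_eq0 invr_eq0 !pnatr_eq0 (negPf card_neq0) orbF.
apply/idP/exists_inP => [|[t Rt st]]; rewrite -lt0n.
  by case/card_gt0P=> t; rewrite inE => /andP[Rt st]; exists t.
by apply/card_gt0P; exists t; rewrite inE Rt.
Qed.

(** Since [omega la] is constant on each cycle type, averaging the indicator of the Young subgroup
    over cycle types does not change its product with [omega la]. *)
Lemma gdot_young_density la mu : gdot (young_density mu) (omega la) =
  (#|Hn n|%:R^-1 * Hn_row_sum (zirr n la) (yrow mu))^*.
Proof.
have st_om (t u : gT) : stype t = stype u -> omega la t = omega la u.
  by apply: biinvariant_stype; apply: omega_biinvariant.
transitivity (\sum_(t in fiber_stab (yrow mu)) (omega la t)^*).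
  rewrite /gdot.
  transitivity (\sum_(s : gT) \sum_(t in fiber_stab (yrow mu) | stype t == stype s)
     (omega la s)^* / #|[pred u : gT | stype u == stype s]|%:R).
    apply: eq_bigr => s _; rewrite sumr_const -[RHS]mulr_natl /young_density mulrAC mulrA.
    by congr (_%:R * _ / _); apply: eq_card => t; rewrite !inE.
  rewrite (exchange_big_dep (mem (fiber_stab (yrow mu)))) /= => [|s t _ /andP[] //].
  apply: eq_bigr => t Rt.
  transitivity (\sum_(s : gT | stype s == stype t)
     (omega la t)^* / #|[pred u : gT | stype u == stype t]|%:R).
    by apply: eq_big => s; rewrite Rt /= eq_sym // => /eqP e; rewrite e (st_om _ _ e).
  rewrite sumr_const -[(_ / _) *+ _]mulr_natr.
  apply: divfK; rewrite pnatr_eq0 -lt0n.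
  by apply/card_gt0P; exists t; rewrite inE.
rewrite -rmorph_sum; congr (_^*); rewrite (reindex_inj invg_inj) /=.
under eq_bigl => t do rewrite groupV.
under eq_bigr => t _ do rewrite omegaE invgK.
by rewrite -mulr_sumr exchange_big.
Qed.

Lemma young_density_expand mu (s : gT) : young_density mu s =
  \sum_(l < N) gdot (young_density mu) (omega (lam l)) / @gdot n (omega (lam l)) (omega (lam l))
    * omega (lam l) s.
Proof. by apply: omega_complete; apply: young_density_stype. Qed.

Lemma gdot_young_neq0 la mu : la \in partitions n -> mu \in partitions n ->
  gdot (young_density mu) (omega la) != 0 -> lexle mu la.
Proof.
move=> Pla Pmu; rewrite gdot_young_density conjC_eq0 mulf_eq0 negb_or => /andP[_ Hr].
apply: (@zirr_row_lexle n) => //; apply: contraNneq Hr => r0.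
rewrite /Hn_row_sum big1 // => h _; under eq_bigr => p _ do rewrite irr_mulC.
by rewrite (group_sum_eq0 (A := fiber_stab_group (yrow mu))).
Qed.

Lemma young_density_rep_neq0 mu rho : mu \in partitions n -> rho \in partitions n ->
  young_density mu (rep n rho) != 0 -> lexle rho mu.
Proof.
move=> Pmu Prho; rewrite young_density_neq0 => /exists_inP[t Rt /eqP].
rewrite stype_rep // => <-.
case/partitionsP: Pmu => smu mu0 sum_mu.
have /partitionsP[_ t0 _] := stype_partition t.
by apply: lexle_tail_sum => // k; apply: stype_refines (doubled_yblock sum_mu) Rt.
Qed.

Lemma young_density_rep_diag mu : mu \in partitions n -> young_density mu (rep n mu) != 0.
Proof.
move=> Pmu; rewrite young_density_neq0 stype_rep //.
case/partitionsP: Pmu => smu mu0 sum_mu; apply/exists_inP.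
exists (row_shift (doubled_yblock sum_mu)); first exact: row_shift_stab.
by rewrite row_shift_stype.
Qed.

Lemma zonal_minor_neq0 k : (k <= N)%N -> \det (zonal_table_minor n k) != 0.
Proof.
move=> le_kN.
have Plam l : (l < N)%N -> lam l \in partitions n by apply: mem_nth.
have lt_N (i : 'I_k) : (i < N)%N := leq_trans (ltn_ord i) le_kN.
pose A i l := gdot (young_density (lam i)) (omega (lam l))
  / @gdot n (omega (lam l)) (omega (lam l)).
have A_eq0 i l : (i < N)%N -> (l < N)%N -> (i < l)%N -> A i l = 0.
  move=> iN lN; apply: contraTeq; rewrite /A mulf_eq0 negb_or -leqNgt => /andP[+ _].
  by move=> /(gdot_young_neq0 (Plam l lN) (Plam i iN))/(nth_partitions_le iN lN).
pose L := \matrix_(i < k, l < k) A i l.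
pose U := \matrix_(i < k, j < k) young_density (lam i) (rep n (lam j)).
have LZ : L *m zonal_table_minor n k = U.
  apply/matrixP => i j; rewrite !mxE young_density_expand.
  rewrite -[RHS](big_mkord xpredT (fun l => A i l * omega (lam l) (rep n (lam j)))).
  (* Row i < k of the coefficient matrix vanishes from column k on, so the expansion restricts to
     the leading block. *)
  rewrite [RHS](big_cat_nat (leq0n k) le_kN) /=.
  have -> : \sum_(k <= l < N) A i l * omega (lam l) (rep n (lam j)) = 0.
    rewrite big_nat big1 // => l /andP[kl lN].
    by rewrite A_eq0 ?mul0r // (leq_trans (ltn_ord i)).
  by rewrite addr0 big_mkord; apply: eq_bigr => l _; rewrite !mxE.
have : \det U != 0.
  rewrite -det_tr det_trig; last first.
    apply/is_trig_mxP => i j lt_ij; rewrite !mxE; apply/eqP.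
    apply: contraTT lt_ij => /(young_density_rep_neq0 (Plam _ (lt_N j)) (Plam _ (lt_N i))).
    by move=> /(nth_partitions_le (lt_N i) (lt_N j)); rewrite -leqNgt.
  by apply/prodf_neq0 => i _; rewrite !mxE young_density_rep_diag ?Plam.
by rewrite -LZ det_mulmx mulf_eq0 negb_or => /andP[].
Qed.

End Triangularity.

(** * Functional equation and bound on the entries *)

Section Bound.
Variable n : nat.
Local Notation T := 'I_(n.*2).
Local Notation gT := {perm T}.
Local Notation cH := (#|Hn n|%:R : algC).
Variable la : seq nat.
Hypothesis Pla : la \in partitions n.
Local Notation chi := 'chi_(zirr n la).

Let w (x : gT) : algC := cH^-1 * \sum_(h in Hn n) chi (h * x)%g.
Let f (g x : gT) : algC := cH^-1 * \sum_(k in Hn n) w (g * k * x)%g.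

Lemma omega_spherical s : omega la s = w s^-1.
Proof. by []. Qed.

Lemma sphericalE g x : f g x =
  cH^-1 ^+ 2 * \sum_(k in Hn n) \sum_(h in Hn n) chi (h * g * k * x)%g.
Proof.
rewrite /f /w -mulr_sumr mulrA expr2; congr (_ * _).
by apply: eq_bigr => k _; apply: eq_bigr => h _; rewrite !mulgA.
Qed.

Lemma spherical_biinvariant g : biinvariant (fun s => f g s^-1).
Proof.
move=> h k s Hh Hk; rewrite !sphericalE; congr (_ * _).
rewrite (reindex_inj (mulIg k)%g) /=; apply: eq_big => [y|y _]; first by rewrite groupMr.
rewrite (reindex_inj (mulgI h)%g) /=; apply: eq_big => [x|x _]; first by rewrite groupMl.
by rewrite !invMg !mulgA mulgK [LHS]irr_mulC !mulgA mulVg mul1g.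
Qed.

Lemma spherical_omega_orthogonal g mu : zirr n la != zirr n mu ->
  gdot (fun s => f g s^-1) (omega mu) = 0.
Proof.
move=> /negPf ne; rewrite /gdot (reindex_inj invg_inj) /=.
under eq_bigr => s _.
  rewrite invgK sphericalE omegaE invgK rmorphM mulrACA rmorph_sum big_distrlr /=; over.
rewrite -mulr_sumr exchange_big big1 ?mulr0 // => y _ /=; rewrite exchange_big big1 // => x _ /=.
under eq_bigr => s _ do rewrite mulr_suml.
rewrite exchange_big big1 // => h _ /=.
by rewrite irr_orthogonality ne !mul0r.
Qed.

(** In the expansion of [omega_complete] only the [la] term survives, by
    [spherical_omega_orthogonal] and the injectivity of [zirr]. *)
Lemma spherical_multiple g : exists a, forall x, f g x = a * w x.
Proof.
have lt_la : (index la (partitions n) < size (partitions n))%N by rewrite index_mem.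
pose l0 := Ordinal lt_la; have lamE : nth [::] (partitions n) l0 = la by rewrite nth_index.
exists (gdot (fun s => f g s^-1) (omega la) / @gdot n (omega la) (omega la)) => x.
have st := fun s t => @biinvariant_stype _ _ s t (spherical_biinvariant g).
have := omega_complete (x^-1)%g st; rewrite invgK => ->.
rewrite (bigD1 l0) //= lamE big1 ?addr0 => [|l ne_l].
  by rewrite omega_spherical invgK.
rewrite spherical_omega_orthogonal ?mul0r //; apply: contraNneq ne_l => /(@zirr_inj n).
move=> /(_ Pla (mem_nth _ (ltn_ord l))) e.
by rewrite -val_eqE /= e index_uniq ?partitions_uniq.
Qed.

(** The multiplicity of the trivial character of [Hn n] in [chi]. *)
Let d := w 1%g.

Lemma spherical_degree_neq0 : d != 0.
Proof.
have [_ _ Hs] := zirrP Pla; rewrite /d /w mulf_neq0 ?invr_eq0 ?card_Hn_neq0 //.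
by under eq_bigr => h _ do rewrite mulg1.
Qed.

(** Taking x = 1 in [spherical_multiple] determines the scalar, because [f g 1] is [w g]. The factor
    [d] stays until it is known to have modulus 1. *)
Lemma spherical_mul g x : d * f g x = w g * w x.
Proof.
have [a fE] := spherical_multiple g; have f1 : f g 1%g = a * d := fE 1%g.
suff <- : f g 1%g = w g by rewrite f1 fE; ring.
have cH0 := card_Hn_neq0 n.
rewrite sphericalE exprS expr1 -mulrA /w; congr (_ * _); apply: (canLR (mulKf cH0)).
rewrite mulr_natl -sumr_const; apply: eq_bigr => k Hk.
rewrite [RHS](reindex_inj (mulgI k)%g) /=; apply: eq_big => [h|h _]; first by rewrite groupMl.
by rewrite mulg1 irr_mulC !mulgA.
Qed.

Lemma spherical_inv x : w x^-1 = (w x)^*.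
Proof.
rewrite /w rmorphM fmorphV rmorph_nat rmorph_sum; congr (_ * _).
rewrite (reindex_inj invg_inj) /=; apply: eq_big => [h|h _]; first by rewrite groupV.
by rewrite -irr_inv invMg irr_mulC.
Qed.

(** Summing [spherical_mul] over g with x the inverse of g compares [d] times [sum_f] with [sum_w];
    cancelling nonzero factors leaves [d ^+ 2 = 1]. *)
Lemma norm_spherical_degree : `|d| = 1.
Proof.
have cH0 := card_Hn_neq0 n; have r0 := irr_ratio_neq0 (zirr n la).
have sum_h : \sum_(h in Hn n) chi h = cH * d.
  by rewrite /d /w mulVKf //; apply: eq_bigr => h _; rewrite mulg1.
have sum_f : \sum_g f g g^-1 = irr_ratio (zirr n la) * d ^+ 2.
  under eq_bigr => g _ do rewrite sphericalE.
  rewrite -mulr_sumr exchange_big.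
  transitivity (cH^-1 ^+ 2 * \sum_(k in Hn n) \sum_(h in Hn n)
     irr_ratio (zirr n la) * (chi h * chi k)).
    congr (_ * _); apply: eq_bigr => k _; rewrite exchange_big; apply: eq_bigr => h _ /=.
    rewrite mulrA -sum_irr_conj [RHS](reindex_inj invg_inj) /=.
    by apply: eq_bigr => g _; rewrite conjgE invgK !mulgA.
  under eq_bigr => k _ do rewrite -mulr_sumr -mulr_suml.
  rewrite -mulr_sumr -mulr_sumr sum_h.
  by move: cH cH0 (irr_ratio _) d => c c0 a b; field.
have sum_w : \sum_g w g * w g^-1 = irr_ratio (zirr n la) * d.
  under eq_bigr => g _.
    rewrite spherical_inv /w rmorphM fmorphV rmorph_nat mulrACA -expr2 rmorph_sum big_distrlr /=; over.
  rewrite -mulr_sumr exchange_big.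
  transitivity (cH^-1 ^+ 2 * \sum_(h in Hn n) irr_ratio (zirr n la) * (cH * d)).
    congr (_ * _); apply: eq_bigr => h Hh; rewrite exchange_big -sum_h mulr_sumr.
    rewrite [RHS](reindex_inj (mulgI h)%g) [RHS](reindex_inj invg_inj) /=.
    apply: eq_big => [k|k _]; first by rewrite groupMl ?groupV.
    by rewrite irr_orthogonality eqxx mul1r.
  rewrite sumr_const -[(irr_ratio _ * _) *+ _]mulr_natr.
  by move: cH cH0 (irr_ratio _) d => c c0 a b; field.
have d0 := spherical_degree_neq0.
have /eqP : d ^+ 2 == 1.
  apply/eqP/(mulfI (mulf_neq0 r0 d0)); rewrite mulr1 -[RHS]sum_w.
  transitivity (d * \sum_g f g g^-1); first by rewrite sum_f; ring.
  by rewrite mulr_sumr; apply: eq_bigr => g _; rewrite spherical_mul.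
move/(congr1 Num.norm); rewrite normrX normr1 => /eqP.
by rewrite sqrp_eq1 // => /eqP.
Qed.

Lemma norm_spherical_le1 x : `|w x| <= 1.
Proof.
have cH0 : 0 < cH by rewrite ltr0n cardG_gt0.
pose g := [arg max_(g > 1%g : gT) `|w g|]%O.
have max_g y : `|w y| <= `|w g|.
  rewrite /g; case: comparable_arg_maxP => // [? ? _ _|i _ /(_ y isT) //].
  by apply: real_comparable; apply: normr_real.
apply: le_trans (max_g x) _.
have [->|g0] := eqVneq (w g) 0; first by rewrite normr0 ler01.
(* [spherical_mul] at x = g makes the left side the modulus of an average of values of [w], each
   bounded by the maximum. *)
have: `|w g| * `|w g| <= `|w g|.
  rewrite -normrM -spherical_mul normrM norm_spherical_degree mul1r /f normrM.
  rewrite normfV normr_nat ler_pdivrMl //.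
  apply: le_trans (ler_norm_sum _ _ _) _.
  apply: le_trans (ler_sum _ (fun k _ => max_g _)) _.
  by rewrite sumr_const mulr_natl.
by rewrite ger_pMr ?normr_gt0.
Qed.

End Bound.

Theorem mainTheorem3 (n : nat) :
  (forall k : nat, (1 <= k <= size (partitions n))%N ->
     \det (zonal_table_minor n k) != 0)
  /\ (forall la rho : seq nat, la \in partitions n -> rho \in partitions n ->
     `|zonal n la rho| <= 1).
Proof.
split=> [k /andP[_ le_k]|la rho Pla _]; first exact: zonal_minor_neq0.
(* [zonal n la rho] unfolds to [w] at the inverse of the chosen permutation. *)
exact: (norm_spherical_le1 Pla).
Qed.
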